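(* Let $n,d$ be positive integers and let $X = H Z$, where $H\in\mathbb{R}^{d\times n}$ is an unknown matrix of full column rank and $Z=(Z_1,\dots,Z_n)^\top$ is an unobserved random vector generated by the structural equations $Z_i = f_i(Z_{pa(i)}) + \mathcal{E}_i$, $i\in[n]$, with respect to an unknown directed acyclic graph $\mathcal{G}$ on $[n]$, where each $f_i$ is twice continuously differentiable and directionally non-linear, and $\mathcal{E}_1,\dots,\mathcal{E}_n$ are mutually independent with $\mathcal{E}_i\sim\mathcal{N}(0,\sigma_i^2)$. Then the exogenous noise variables $\mathcal{E}=(\mathcal{E}_1,\dots,\mathcal{E}_n)^\top$ are identifiable up to layers from the distribution $p_X$ of $X$ alone: it is possible to learn from $p_X$ a map $\hat{\mathcal{E}}:\mathbb{R}^d\to\mathbb{R}^n$ such that $\hat{\mathcal{E}}(X) = P_\pi\, C\, \mathcal{E}$ for all $\mathcal{E}\in\mathbb{R}^n$, where $P_\pi\in\mathbb{R}^{n\times n}$ is a permutation matrix and $C\in\mathbb{R}^{n\times n}$ is a constant matrix with non-zero diagonal entries and $C_{ij}=0$ whenever $i\in layer(k)$ and $j\notin layer(k)$.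
   Context: $pa(i)$ denotes the set of parents of node $i$ in $\mathcal{G}$ and $Z_{pa(i)}$ the corresponding subvector. A function $f_i:\mathbb{R}^{|pa(i)|}\to\mathbb{R}$ is directionally non-linear if there is no $\beta\in\mathbb{R}^{|pa(i)|}$ with $\|\beta\|_2=1$ such that the second directional derivative $\partial^2_{\beta,\beta} f_i(z)=0$ for all $z$. A leaf node is a node with no descendants in $\mathcal{G}$. For $k\ge 0$, $layer(k)$ is the set of nodes of $\mathcal{G}$ whose longest directed path to a leaf node has length $k$. Only samples of $X$ (equivalently, the distribution $p_X$) are available; no interventions. *)

(* Defs.v *)
From HB Require Import structures.
From mathcomp Require Import all_boot all_order all_algebra all_fingroup.
From mathcomp Require Import all_classical all_reals all_analysis.
Set Implicit Arguments. Unset Strict Implicit. Unset Printing Implicit Defensive.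
Import Order.TTheory GRing.Theory Num.Theory.
Import numFieldNormedType.Exports.
Local Open Scope classical_set_scope.
Local Open Scope ring_scope.

(* Graphs on [n] = 'I_n : [G u v] means there is a directed edge u -> v,
   so the parents of i are pa(i) = [set j | G j i]. *)

Definition dag n (G : rel 'I_n) : Prop :=
  forall u v, G u v -> ~~ connect G v u.

Definition leaf n (G : rel 'I_n) (i : 'I_n) : Prop := forall j, ~~ G i j.

Definition in_layer n (G : rel 'I_n) (k : nat) (i : 'I_n) : Prop :=
  (exists s : seq 'I_n, [/\ size s = k, path G i s & leaf G (last i s)]) /\
  (forall s : seq 'I_n, path G i s -> leaf G (last i s) -> (size s <= k)%N).

(* f : R^n -> R depends only on the coordinates in pa(i), i.e. it is
   (the composition with the projection z |-> z_pa(i) of) a function of Z_pa(i) *)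
Definition depends_only_on_parents (R : realType) n (G : rel 'I_n) (i : 'I_n)
  (f : 'cV[R]_n -> R) : Prop :=
  forall z z' : 'cV[R]_n, (forall j, G j i -> z j ord0 = z' j ord0) -> f z = f z'.

Definition twice_cont_diff (R : realType) n (f : 'cV[R]_n -> R) : Prop :=
  forall u v : 'cV[R]_n,
    (forall z, derivable f z u) /\
    (forall z, derivable ('D_u f) z v) /\
    continuous ('D_v ('D_u f)).

(* directionally non-linear (as a function of Z_pa(i)): there is no unit vector
   beta in R^{|pa(i)|} (viewed in R^n, supported on pa(i)) with
   second directional derivative d^2_{beta,beta} f = 0 everywhere *)
Definition directionally_nonlinear (R : realType) n (G : rel 'I_n) (i : 'I_n)
  (f : 'cV[R]_n -> R) : Prop :=
  ~ exists beta : 'cV[R]_n,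
      [/\ forall j, ~~ G j i -> beta j ord0 = 0,
          \sum_(j < n) beta j ord0 ^+ 2 = 1 &
          forall z, 'D_beta ('D_beta f) z = 0].

Definition mutually_independent d (T : measurableType d) (R : realType)
  (P : probability T R) n (E : 'I_n -> T -> R) : Prop :=
  forall B : 'I_n -> set R, (forall i, measurable (B i)) ->
    P (\bigcap_(i in [set: 'I_n]) (E i @^-1` B i)) =
    (\prod_(i < n) P (E i @^-1` B i))%E.

Definition layer_block (R : realType) n (G : rel 'I_n) (C : 'M[R]_n) : Prop :=
  forall k i j, in_layer G k i -> ~ in_layer G k j -> C i j = 0.

(* Main.v *)
Require Import Defs.
From HB Require Import structures.
From mathcomp Require Import all_boot all_order all_algebra all_fingroup.
From mathcomp Require Import all_classical all_reals all_analysis.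
From mathcomp Require Import measurable_realfun ring lra.
Set Implicit Arguments. Unset Strict Implicit. Unset Printing Implicit Defensive.
Import Order.TTheory GRing.Theory Num.Theory.
Import numFieldNormedType.Exports.
Local Open Scope classical_set_scope.
Local Open Scope ring_scope.

(* [Learn pX] picks any model generating [pX] and returns its noise; so two models with
   matrices [H], [H'] and the same law have to be compared.  The column space of [H] is
   the support of the law, whence [H' = H A].  The law of [Z] has a continuous positive
   density with respect to an iterated (hence translation invariant) Lebesgue integral,
   so the ratios of the density at two points can be read off the law on small open sets;
   therefore the energy [q = \sum_i (e_i / sigma_i)^2], with [e_i = z_i - f_i z], is the
   same function for both models, up to the change of variables [A].

   Let [q_k] be the part of [q] carried by the layers [>= k].  If [b] is supported on the
   layers [<= k], then [q_k] is quadratic along [b] with constant second difference;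
   directional non-linearity gives the converse, so [A] preserves these subspaces.  For
   such [b], [q_k (z + b) - q_k (z - b)] is a linear form in the noise of layer [k], so the
   noise of that layer in one model is a linear function of the noise of that layer in
   the other, and minimizing [q_k] along these [b] gives [q_{k+1}]. *)

(** * Layers and energies *)

Section layers.
Variables (n : nat) (G : rel 'I_n).
Hypothesis dagG : dag G.

Lemma dag_path_uniq x (s : seq 'I_n) : path G x s -> uniq (x :: s).
Proof.
elim: s x => [//|y s IH] x /= /andP[Gxy ys].
have /= -> := IH y ys; rewrite andbT.
apply/negP => xs; have /negP := dagG Gxy; apply.
by apply: path_connect ys _ _.
Qed.

(** The layer of [i] is the length of a longest path out of [i], which exists because paths in a dag
    repeat no vertex. A longest path ends at a leaf, as it could be prolonged otherwise; its second
    vertex gives the last clause. *)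
Lemma exists_layering : exists lay : 'I_n -> nat,
  [/\ forall i, in_layer G (lay i) i,
      forall u v, G u v -> (lay v < lay u)%N &
      forall k u, (k < lay u)%N -> exists2 v, G u v & (k <= lay v)%N].
Proof.
pose Q i (m : nat) := `[< exists2 s : seq 'I_n, size s = m & path G i s >].
have Q0 i : exists m, Q i m by exists 0%N; apply/asboolP; exists [::].
have Qn i m : Q i m -> (m <= n)%N.
  move=> /asboolP[s <- /dag_path_uniq us].
  have : (size (i :: s) <= size (enum 'I_n))%N.
    by apply: uniq_leq_size us _ => x _; rewrite mem_enum.
  by rewrite size_enum_ord => /ltnW.
pose lay i := ex_maxn (Q0 i) (Qn i).
have layP i : exists2 s, size s = lay i & path G i s.
  by rewrite /lay; case: ex_maxnP => m /asboolP.
have layM i s : path G i s -> (size s <= lay i)%N.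
  by rewrite /lay; case: ex_maxnP => m _ + ps; apply; apply/asboolP; exists s.
have layG u v : G u v -> (lay v < lay u)%N.
  by move=> Guv; have [s <- ps] := layP v; apply: (layM u (v :: s)); rewrite /= Guv.
exists lay; split => //.
  move=> i; split; last by move=> s ps _; exact: layM.
  have [s ss ps] := layP i; exists s; split => // j; apply/negP => Gj.
  have /layM : path G i (rcons s j) by rewrite rcons_path ps.
  by rewrite size_rcons ss ltnn.
move=> k u ku; have [[|v s] /= ss] := layP u; first by rewrite -ss in ku.
move=> /andP[Guv ps]; exists v => //.
by apply: leq_trans (layM _ _ ps); rewrite -ltnS ss.
Qed.

Lemma in_layer_inj k l i : in_layer G k i -> in_layer G l i -> k = l.
Proof.
move=> [[s [<- ps ls]] mk] [[t [<- pt lt]] ml].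
by apply/eqP; rewrite eqn_leq mk// ml.
Qed.

End layers.

Definition noise (R : realType) n (f : 'I_n -> 'cV[R]_n -> R) (z : 'cV[R]_n) : 'cV[R]_n :=
  \col_i (z i ord0 - f i z).

Definition energy (R : realType) n (f : 'I_n -> 'cV[R]_n -> R) (sigma : 'I_n -> R)
    (lay : 'I_n -> nat) (k : nat) (z : 'cV[R]_n) : R :=
  \sum_(i < n | (k <= lay i)%N) (noise f z i ord0 / sigma i) ^+ 2.

Definition below (R : realType) n (lay : 'I_n -> nat) (k : nat) (b : 'cV[R]_n) : Prop :=
  forall j, (k <= lay j)%N -> b j ord0 = 0.

(** The deterministic content of a model, free of probability and smoothness. Longest paths enter
    through [scm_child]: every node above layer [k] has a child still in the layers [>= k]. *)
Record layered_scm (R : realType) n (G : rel 'I_n) (f : 'I_n -> 'cV[R]_n -> R)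
    (sigma : 'I_n -> R) (lay : 'I_n -> nat) : Prop := LayeredScm {
  scm_parents : forall i, depends_only_on_parents G i (f i);
  scm_nonlinear : forall i, directionally_nonlinear G i (f i);
  scm_sigma : forall i, 0 < sigma i;
  scm_lay : forall u v, G u v -> (lay v < lay u)%N;
  scm_child : forall k u, (k < lay u)%N -> exists2 v, G u v & (k <= lay v)%N }.

Section one_model.
Context {R : realType} {n : nat} {G : rel 'I_n} {f : 'I_n -> 'cV[R]_n -> R}
  {sigma : 'I_n -> R} {lay : 'I_n -> nat}.
Hypothesis M : layered_scm G f sigma lay.
Implicit Types (z b e : 'cV[R]_n) (k : nat).

Local Notation q := (energy f sigma lay).

(** The structural equations are solved from the top layer downwards, parents lying in strictly
    higher layers. *)
Lemma noise_surj e : exists z, noise f z = e.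
Proof.
(* [N] exceeds every layer, so the condition is vacuous at [m = 0] and holds for all nodes at
   [m = N]. *)
pose N := (\max_(i < n) lay i).+1.
suff H m : exists z, forall i, (N <= lay i + m)%N -> z i ord0 = f i z + e i ord0.
  have [z zP] := H N; exists z; apply/matrixP => i j; rewrite !ord1 !mxE.
  by rewrite zP ?leq_addl//; lra.
elim: m => [|m [z zP]].
  exists 0 => i; rewrite addn0 => Ni.
  by have := leq_bigmax (F := lay) i; rewrite leqNgt Ni.
exists (\col_i (if (N == lay i + m.+1)%N then f i z + e i ord0 else z i ord0)).
set z' := \col_i _ => i Ni.
have fE : f i z' = f i z.
  apply: (scm_parents M) => j /(scm_lay M) ij; rewrite mxE ifN//.
  by rewrite neq_ltn (leq_ltn_trans Ni)// ltn_add2r.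
rewrite fE mxE; case: eqVneq Ni => // NE Ni.
by rewrite zP//; move: Ni NE; rewrite leq_eqVlt => /orP[/eqP->|]; rewrite ?eqxx// addnS.
Qed.

(** The parents of a node of layer [>= k] lie in layers [> k], where [b] vanishes, so [f i] does not
    see the shift. *)
Lemma noise_shift k z b i : below lay k.+1 b -> (k <= lay i)%N ->
  noise f (z + b) i ord0 = noise f z i ord0 + b i ord0.
Proof.
move=> Vb ki; rewrite !mxE.
have -> : f i (z + b) = f i z.
  apply: (scm_parents M) => j /(scm_lay M) ij.
  by rewrite mxE Vb ?addr0//; exact: leq_ltn_trans ij.
by lra.
Qed.

Lemma below_opp k b : below lay k b -> below lay k (- b).
Proof. by move=> Vb j /Vb; rewrite mxE => ->; rewrite oppr0. Qed.

Lemma below_scale k b (t : R) : below lay k b -> below lay k (t *: b).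
Proof. by move=> Vb j /Vb; rewrite mxE => ->; rewrite mulr0. Qed.

(** Polarization: by [noise_shift] each term is [(x + y)^2 - (x - y)^2], up to scaling, and [b]
    vanishes above layer [k]. *)
Lemma energy_diff k z b : below lay k.+1 b ->
  q k (z + b) - q k (z - b) =
  4 * \sum_(i < n | lay i == k) b i ord0 * noise f z i ord0 / sigma i ^+ 2.
Proof.
move=> Vb; rewrite -sumrB mulr_sumr (bigID (fun i => lay i == k)) /=.
rewrite [X in _ + X]big1 ?addr0 => [|i /andP[ki nk]]; last first.
  have Vi : b i ord0 = 0 by apply: Vb; rewrite ltn_neqAle eq_sym nk.
  by rewrite (noise_shift _ Vb ki) (noise_shift _ (below_opp Vb) ki) !mxE Vi; ring.
apply: eq_big => [i|i /andP[ki _]].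
  by case: eqVneq => [->|]; rewrite ?leqnn ?andbF.
rewrite (noise_shift _ Vb ki) (noise_shift _ (below_opp Vb) ki).
rewrite [(- b) i ord0]mxE -exprVn.
move: (noise f z i ord0) (b i ord0) (sigma i)^-1 => x y u; ring.
Qed.

(** A derivative-free form of a constant second derivative along [b]; stated with differences, it
    passes through linear changes of variables. *)
Definition flat k b := forall (t : R) z z',
  q k (z + t *: b) + q k (z - t *: b) - 2 * q k z =
  q k (z' + t *: b) + q k (z' - t *: b) - 2 * q k z'.

Lemma below_flat k b : below lay k.+1 b -> flat k b.
Proof.
move=> Vb t z z'.
have E y : q k (y + t *: b) + q k (y - t *: b) - 2 * q k y =
    \sum_(i < n | (k <= lay i)%N) 2 * (t * b i ord0 / sigma i) ^+ 2.
  rewrite -big_split mulr_sumr -sumrB; apply: eq_bigr => i ki /=.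
  have Vtb := below_scale t Vb.
  by rewrite (noise_shift _ Vtb ki) (noise_shift _ (below_opp Vtb) ki) !mxE; ring.
by rewrite !E.
Qed.

Lemma midpoint_affine_second_derivative0 (g : 'cV[R]_n -> R) b :
  (forall t z, g (z + t *: b) + g (z - t *: b) = 2 * g z) ->
  forall z, 'D_b ('D_b g) z = 0.
Proof.
move=> gmid.
have incr s h z : g (h *: b + (s *: b + z)) - g (s *: b + z) = g (h *: b + z) - g z.
  (* The parameters [0, s + h] and [s, h] have the same midpoint [(s + h) / 2], so both pairs give
     the same sum of values of [g]. *)
  have := gmid ((s + h) / 2) (z + ((s + h) / 2) *: b).
  have := gmid ((s - h) / 2) (z + ((s + h) / 2) *: b).
  rewrite -!addrA -!(scalerDl b) -!(scalerBl _ _ b).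
  have -> : (s + h) / 2 + (s - h) / 2 = s by field.
  have -> : (s + h) / 2 - (s - h) / 2 = h by field.
  have -> : (s + h) / 2 + (s + h) / 2 = s + h by field.
  rewrite subrr scale0r addr0 ![_ *: b + _]addrC -addrA -scalerDl.
  lra.
have D s z : 'D_b g (s *: b + z) = 'D_b g z.
  by rewrite /derive; under eq_fun do rewrite /= incr.
move=> z; rewrite {1}/derive.
under eq_fun do rewrite /= D subrr scaler0.
exact: lim_cst.
Qed.

(** If [b] charged a node above layer [k], some node of layer [>= k] would have a parent in the
    support of [b]. For such a node [i] of least layer, flatness forces [f i] to be affine along
    [b], against directional non-linearity. *)
Lemma flat_below k b : flat k b -> below lay k.+1 b.
Proof.
move=> fl j kj; apply/eqP/negPn/negP => bj0.
pose Q i := (k <= lay i)%N && [exists j, G j i && (b j ord0 != 0)].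
have [i0 Gji0 ki0] := scm_child M kj.
have Qi0 : Q i0 by rewrite /Q ki0; apply/existsP; exists j; rewrite Gji0.
case: (arg_minnP lay Qi0) => i /andP[ki /existsP[l /andP[Gli bl0]]] imin.
have noG u : (lay i <= lay u)%N -> ~~ G i u.
  by move=> iu; apply/negP => /(scm_lay M); rewrite ltnNge iu.
pose del : 'cV[R]_n := delta_mx i ord0.
have fdel u z : ~~ G i u -> f u (z + del) = f u z.
  move=> nG; apply: (scm_parents M) => v Gvu; rewrite !mxE.
  by case: eqVneq => [vi|]; [rewrite -vi Gvu in nG|rewrite addr0].
(* By minimality of [lay i], the coordinate [z i] enters the second difference of [q k]
   along [b] through the term of index [i] only, linearly, and its coefficient is the
   second difference of [f i]. *)
have mid t z : f i (z + t *: b) + f i (z - t *: b) = 2 * f i z.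
  have /eqP := fl t (z + del) z.
  rewrite -subr_eq0 /energy !mulr_sumr -!big_split /= -!sumrB.
  rewrite (bigD1 i) //= big1 ?addr0 => [|u /andP[ku ui]]; last first.
    have [Qu|nQu] := boolP (Q u).
      have nG : ~~ G i u by exact/noG/imin.
      rewrite !mxE ![z + del + _]addrAC !fdel// (negbTE ui) /=.
      by rewrite !addr0 subrr.
    have fb s y : f u (y + s *: b) = f u y.
      apply: (scm_parents M) => v Gvu; rewrite !mxE.
      have [->|bv] := eqVneq (b v ord0) 0; first by rewrite mulr0 addr0.
      move: nQu; rewrite /Q ku => /existsP; case.
      by exists v; rewrite Gvu.
    have fbN s y : f u (y - s *: b) = f u y by rewrite -scaleNr fb.
    by rewrite !mxE !fb !fbN; ring.
  rewrite !mxE ![z + del + _]addrAC !fdel ?noG// !eqxx /=.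
  set a := f i _; set c := f i (_ - _); set d := f i z.
  have si : sigma i != 0 by rewrite gt_eqF// (scm_sigma M).
  move: (z i ord0) (t * b i ord0) => x p /eqP E.
  apply/eqP; rewrite -subr_eq0 -(mulrI_eq0 _ (mulfI (_ : - 2 / sigma i ^+ 2 != 0))).
    by rewrite -E; apply/eqP; field.
  by rewrite mulf_neq0 ?invr_neq0 ?expf_neq0// oppr_eq0.
(* Restricting [b] to the parents of [i] and dividing by the norm gives the forbidden unit
   direction; the parent [l] makes the norm nonzero. *)
pose c := Num.sqrt (\sum_(u < n | G u i) b u ord0 ^+ 2).
have c0 : 0 < c.
  rewrite sqrtr_gt0 (bigD1 l) //= ltr_pwDl ?exprn_even_gt0//.
  by apply: sumr_ge0 => u _; exact: sqr_ge0.
pose beta : 'cV[R]_n := \col_u (if G u i then b u ord0 / c else 0).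
apply: (@scm_nonlinear _ _ _ _ _ _ M i); exists beta; split.
- by move=> u /negbTE nG; rewrite mxE nG.
- under eq_bigr => u _ do rewrite mxE (fun_if (fun x => x ^+ 2)) expr0n /=.
  rewrite -big_mkcond /=; under eq_bigr do rewrite expr_div_n.
  rewrite -mulr_suml /c sqr_sqrtr ?divff//.
    by rewrite gt_eqF// -sqrtr_gt0.
  by apply: sumr_ge0 => u _; exact: sqr_ge0.
- apply: midpoint_affine_second_derivative0 => t z.
  rewrite -(mid (t / c) z).
  by congr (_ + _); apply: (scm_parents M) => u Gui; rewrite !mxE Gui; ring.
Qed.

End one_model.

(** * Transfer of layers, energies and noises between two models *)

Section two_models.
Context {R : realType} {n : nat}.
Implicit Types (G : rel 'I_n) (f : 'I_n -> 'cV[R]_n -> R) (sigma : 'I_n -> R)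
  (lay : 'I_n -> nat) (A B : 'M[R]_n).

(** In each model flatness characterizes these subspaces, and flatness only depends on the energy,
    which the two models share up to [A]. *)
Lemma below_transfer {G f sigma lay G' f' sigma' lay' A B} k :
  layered_scm G f sigma lay -> layered_scm G' f' sigma' lay' ->
  A *m B = 1%:M ->
  (forall z, energy f sigma lay k (A *m z) = energy f' sigma' lay' k z) ->
  forall b, below lay' k.+1 b -> below lay k.+1 (A *m b).
Proof.
move=> M M' AB qq b /(below_flat M') fl; apply: (flat_below M) => t z z'.
rewrite -[z]mul1mx -[z']mul1mx -AB -!mulmxA scalemxAr -!mulmxDr -!mulmxBr !qq.
exact: fl.
Qed.

Lemma energy_split f sigma lay k z :
  energy f sigma lay k z =
  \sum_(i < n | lay i == k) (noise f z i ord0 / sigma i) ^+ 2 + energy f sigma lay k.+1 z.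
Proof.
rewrite /energy (bigID (fun i => lay i == k)) /=.
congr (_ + _); apply: eq_bigl => i; first by case: eqVneq => [->|]; rewrite ?leqnn ?andbF.
by rewrite ltn_neqAle andbC eq_sym.
Qed.

Lemma energy_next_le {G f sigma lay G' f' sigma' lay' A B} k :
  layered_scm G f sigma lay -> layered_scm G' f' sigma' lay' ->
  A *m B = 1%:M -> B *m A = 1%:M ->
  (forall z, energy f sigma lay k (A *m z) = energy f' sigma' lay' k z) ->
  forall z, energy f' sigma' lay' k.+1 z <= energy f sigma lay k.+1 (A *m z).
Proof.
move=> M M' AB BA qq z; set y := A *m z.
pose b : 'cV[R]_n := \col_i (if lay i == k then - noise f y i ord0 else 0).
have Vb : below lay k.+1 b by move=> j kj; rewrite mxE gtn_eqF.
have VBb : below lay' k.+1 (B *m b).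
  apply: below_transfer M' M BA _ b Vb => x.
  by rewrite -qq mulmxA AB mul1mx.
(* [y + b] minimizes [energy k] on [y + below k.+1]. *)
have -> : energy f sigma lay k.+1 y = energy f sigma lay k (y + b).
  rewrite (energy_split f sigma lay k (y + b)) big1 ?add0r => [|i /eqP ik]; last first.
    by rewrite (noise_shift M _ Vb) ?ik// [b _ _]mxE ik eqxx subrr mul0r expr0n.
  apply: eq_bigr => i ki; rewrite (noise_shift M _ Vb) ?(ltnW ki)//.
  by rewrite [b _ _]mxE gtn_eqF// addr0.
have -> : y + b = A *m (z + B *m b) by rewrite mulmxDr mulmxA AB mul1mx.
rewrite qq (energy_split _ _ _ k).
have -> : energy f' sigma' lay' k.+1 (z + B *m b) = energy f' sigma' lay' k.+1 z.
  apply: eq_bigr => i ki; rewrite (noise_shift M' _ VBb) ?(ltnW ki)//.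
  by rewrite VBb// addr0.
by rewrite lerDr; apply: sumr_ge0 => i _; exact: sqr_ge0.
Qed.

Lemma energy_transfer {G f sigma lay G' f' sigma' lay' A B} :
  layered_scm G f sigma lay -> layered_scm G' f' sigma' lay' ->
  A *m B = 1%:M -> B *m A = 1%:M ->
  (forall z, energy f sigma lay 0 (A *m z) = energy f' sigma' lay' 0 z) ->
  forall k z, energy f sigma lay k (A *m z) = energy f' sigma' lay' k z.
Proof.
move=> M M' AB BA q0; elim=> [//|k qk] z.
apply: le_anti; rewrite (energy_next_le M M' AB BA qk) andbT.
rewrite -{2}[z]mul1mx -BA -mulmxA.
apply: (energy_next_le M' M BA AB) => x.
by rewrite -qk mulmxA AB mul1mx.
Qed.

Lemma noise_linear {G f sigma lay G' f' sigma' lay' A B} :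
  layered_scm G f sigma lay -> layered_scm G' f' sigma' lay' ->
  A *m B = 1%:M -> B *m A = 1%:M ->
  (forall z, energy f sigma lay 0 (A *m z) = energy f' sigma' lay' 0 z) ->
  exists N : 'M[R]_n, [/\ N \in unitmx,
    forall i j, lay' i != lay j -> N i j = 0 &
    forall z, noise f' z = N *m noise f (A *m z)].
Proof.
move=> M M' AB BA q0; have qq := energy_transfer M M' AB BA q0.
(* These coefficients come from [energy_diff] along the [i]-th basis vector: in the second model it
   isolates the noise of [i], and in the first the vector becomes column [i] of [A]. *)
pose N : 'M[R]_n := \matrix_(i, j)
  if lay j == lay' i then sigma' i ^+ 2 * A j i / sigma j ^+ 2 else 0.
have NP z : noise f' z = N *m noise f (A *m z).
  apply/matrixP => i o; rewrite !ord1 {o}.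
  pose b : 'cV[R]_n := delta_mx i ord0.
  have Vb : below lay' (lay' i).+1 b.
    by move=> j ij; rewrite mxE; case: eqVneq ij => [->|//]; rewrite ltnn.
  have VAb := below_transfer M M' AB (qq _) Vb.
  have n4 : (4 : R) != 0 by rewrite pnatr_eq0.
  have := energy_diff M' z Vb.
  rewrite -!qq mulmxDr mulmxBr (energy_diff M (A *m z) VAb).
  move=> /(mulfI n4); rewrite [X in _ = X -> _](bigD1 i) //=.
  rewrite [X in _ + X]big1 ?addr0 => [|j /andP[_ ji]]; last first.
    by rewrite mxE (negbTE ji) !mul0r.
  rewrite [b i ord0]mxE !eqxx mul1r => E.
  have s0 : sigma' i ^+ 2 != 0 by rewrite expf_neq0// gt_eqF// (scm_sigma M').
  rewrite -[LHS](mulfVK s0) -E mulr_suml mxE [RHS](bigID (fun j => lay j == lay' i)) /=.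
  rewrite [X in _ = _ + X]big1 ?addr0 => [|j /negbTE ji]; last by rewrite mxE ji mul0r.
  apply: eq_bigr => j ji; rewrite [N i j]mxE ji -colE mxE; ring.
exists N; split => //.
(* Invertibility comes from surjectivity of the noise: preimages of the basis vectors provide the
   columns of a right inverse. *)
- have [Y YP] := choice (fun e => noise_surj M' e).
  pose W := \matrix_(i, j) noise f (A *m Y (delta_mx j ord0)) i ord0.
  suff /mulmx1_unit[] : N *m W = 1%:M by [].
  apply/matrixP => i j; rewrite [RHS]mxE.
  have := congr1 (fun v : 'cV[R]_n => v i ord0) (NP (Y (delta_mx j ord0))).
  rewrite YP [in LHS]mxE eqxx andbT => ->.
  by rewrite !mxE; apply: eq_bigr => l _; rewrite !mxE.
- by move=> i j ij; rewrite mxE eq_sym (negbTE ij).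
Qed.

(* A nonzero term of the Leibniz expansion of [\det N] supplies the permutation. *)
Lemma unitmx_block_perm {lay lay' : 'I_n -> nat} {N : 'M[R]_n} :
  N \in unitmx -> (forall i j, lay' i != lay j -> N i j = 0) ->
  exists (s : 'S_n) (C : 'M[R]_n), [/\ N = perm_mx s *m C,
    forall i, C i i != 0 & forall i j, lay i != lay j -> C i j = 0].
Proof.
move=> uN N0.
have [s sP] : exists s : 'S_n, forall i, N i (s i) != 0.
  apply: contrapT => /forallNP nex; move: uN; rewrite unitmxE unitfE /determinant.
  rewrite big1 ?eqxx// => s _; apply/eqP; rewrite mulf_eq0; apply/orP; right.
  have /existsNP[i /negP/negPn/eqP Ni] := nex s.
  by rewrite (bigD1 i) //= Ni mul0r.
exists s, (row_perm s^-1 N); split.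
- by rewrite -row_permE -row_permM mulgV row_perm1.
- by move=> i; rewrite mxE; have := sP (s^-1%g i); rewrite permKV.
(* Row [i] of [C] is row [s^-1 i] of [N], whose nonzero entry in column [i] shows that [s^-1 i] has
   in the second model the layer of [i] in the first. *)
- move=> i j ij; rewrite mxE; apply: (N0); apply: contra_neq ij => <-.
  have := sP (s^-1%g i); rewrite permKV.
  by apply: contra_neq_eq => ij; rewrite N0// eq_sym.
Qed.

End two_models.

(** * Continuity from directional derivatives *)

Section directional_C1_continuous.
Context {R : realType} {n : nat}.
Implicit Types (g : 'cV[R]_n -> R) (u v z : 'cV[R]_n).

Lemma is_derive_line g u z (t : R) : derivable g (z + t *: u) u ->
  is_derive t 1 (fun s : R => g (z + s *: u)) ('D_u g (z + t *: u)).
Proof.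
move=> dg.
have E : (fun h : R => h^-1 *: (g (z + (h *: (1 : R^o) + t) *: u) - g (z + t *: u))) =
         (fun h : R => h^-1 *: ((g \o shift (z + t *: u)) (h *: u) - g (z + t *: u))).
  apply/funext => h /=; congr (_ *: (g _ - _)).
  by rewrite [h *: 1]mulr1 scalerDl addrCA.
by split; [rewrite /derivable /= E|rewrite /derive /= E].
Qed.

Lemma line_MVT_bound g u z (t K : R) :
  (forall s, `|s| <= `|t| -> derivable g (z + s *: u) u) ->
  (forall s, `|s| <= `|t| -> `|'D_u g (z + s *: u)| <= K) ->
  `|g (z + t *: u) - g z| <= K * `|t|.
Proof.
move=> dg gK.
have H (a b : R) : a <= b -> (forall s, s \in `[a, b] -> `|s| <= `|t|) ->
    `|g (z + b *: u) - g (z + a *: u)| <= K * (b - a).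
  move=> ab abt.
  pose phi (s : R) : R := g (z + s *: u); pose dphi (s : R) : R := 'D_u g (z + s *: u).
  have D s : s \in `[a, b] -> is_derive s 1 phi (dphi s).
    by move=> /abt /dg; exact: is_derive_line.
  have Doo s : s \in `]a, b[ -> is_derive s 1 phi (dphi s).
    by move=> sab; apply: D; exact: subset_itv_oo_cc sab.
  have Dc : {within `[a, b], continuous phi}.
    by apply: derivable_within_continuous => s /D [].
  have [c cab E] := MVT_segment ab Doo Dc.
  rewrite -/(phi b) -/(phi a) E normrM (ger0_norm (_ : 0 <= b - a)) ?subr_ge0//.
  by rewrite ler_wpM2r ?subr_ge0// gK// abt.
have [t0|t0] := leP 0 t.
  have := H 0 t t0; rewrite scale0r addr0 subr0 ger0_norm//; apply => s.
  by rewrite in_itv /= => /andP[s0 st]; rewrite ger0_norm.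
have := H t 0 (ltW t0); rewrite scale0r addr0 sub0r distrC ltr0_norm//; apply => s.
by rewrite in_itv /= => /andP[ts s0]; rewrite ler0_norm// lerN2.
Qed.

(* Moves from [z] to [z + h] one coordinate at a time. *)
Lemma directional_C1_continuous g :
  (forall v, (forall z, derivable g z v) /\ continuous ('D_v g)) -> continuous g.
Proof.
move=> g1 z.
pose mix (s : seq 'I_n) (y : 'cV[R]_n) : 'cV[R]_n :=
  \col_i (if i \in s then y i ord0 else z i ord0).
suff H (s : seq 'I_n) : uniq s -> forall eps : R, 0 < eps ->
    \forall y \near z, `|g (mix s y) - g z| < eps.
  apply/(@cvgrPdist_lt R R 'cV[R]_n (nbhs z) (nbhs_filter z)) => eps e0.
  apply: filterS (H (enum 'I_n) (enum_uniq _) _ e0) => y.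
  have -> : mix (enum 'I_n) y = y.
    by apply/matrixP => i j; rewrite mxE mem_enum !ord1.
  by rewrite distrC.
elim: s => [_ eps e0|i s IH /= /andP[nis us] eps e0].
  apply: (@filterS _ (nbhs z) (nbhs_filter z) setT) => [y _|]; last exact: filterT.
  rewrite (_ : mix [::] y = z) ?subrr ?normr0//.
  by apply/matrixP => j k; rewrite mxE !ord1.
pose u : 'cV[R]_n := delta_mx i ord0.
have [gu cDu] := g1 u.
have /nbhs_ballP[d /= d0 Hd] : nbhs z [set x | `|'D_u g x| < `|'D_u g z| + 1].
  have : \forall x \near z, `|'D_u g z - 'D_u g x| < 1.
    by move: (cDu z) => /cvgrPdist_lt; apply.
  apply: filterS => x /= H; rewrite -ltrBlDl; apply: le_lt_trans H.
  by rewrite distrC lerB_dist.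
pose K := `|'D_u g z| + 1; have K0 : 0 < K by rewrite ltr_wpDl.
have e20 : 0 < eps / 2 by rewrite divr_gt0.
near=> y.
have zy : ball z d y by near: y; exact: nbhsx_ballx.
have zyK : ball z (eps / 2 / K) y by near: y; apply: nbhsx_ballx; rewrite divr_gt0.
have -> : mix (i :: s) y = mix s y + (y i ord0 - z i ord0) *: u.
  apply/matrixP => j k; rewrite !mxE !ord1 in_cons andbT.
  case: eqVneq => [->|ji] /=; last by rewrite mulr0 addr0.
  by rewrite (negbTE nis) mulr1 addrC subrK.
rewrite [eps]splitr -(subrK (g (mix s y)) (g (_ + _ *: u))) -addrA.
apply: le_lt_trans (ler_normD _ _) _; apply: ltrD; last by near: y; exact: (IH us _ e20).
apply: (@le_lt_trans _ _ (K * `|y i ord0 - z i ord0|)).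
  apply: line_MVT_bound => x xt; first exact: gu.
  (* Balls are products of intervals, so it suffices that coordinate [i] stays within [|y i - z i|]
     of [z i], the others being those of [y] or [z]. *)
  apply/ltW/Hd; split => // j k; rewrite /ball /= !mxE !ord1 andbT.
  have [zyd zyj] := zy; have := zyj j ord0; have := zyj i ord0; rewrite /ball /= => zi zj.
  case: eqVneq => [->|ji] /=.
    by rewrite (negbTE nis) mulr1 opprD addrA subrr sub0r normrN (le_lt_trans xt)// distrC.
  by rewrite mulr0 addr0; case: ifP => // _; rewrite subrr normr0.
have [_ /(_ i ord0)] := zyK.
by rewrite /ball /= ltr_pdivlMr// mulrC distrC.
Unshelve. all: by end_near. Qed.

Lemma twice_cont_diff_continuous g : twice_cont_diff g -> continuous g.
Proof.
move=> g2; apply: directional_C1_continuous => v.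
split; first by have [] := g2 v v.
by apply: directional_C1_continuous => w; have [_ []] := g2 v w.
Qed.

End directional_C1_continuous.

(** * Measurability on column vectors *)

Definition coord_cylinders (R : realType) n : set (set 'cV[R]_n) :=
  [set A | exists (i : 'I_n) (B : set R), measurable B /\ A = [set v : 'cV[R]_n | B (v i ord0)]].

Notation mcol R n := (g_sigma_algebraType (@coord_cylinders R n)).

Section measurable_columns.
Context {R : realType} {n : nat}.
Local Notation mV := (mcol R n).

Lemma measurable_coord (i : 'I_n) : measurable_fun setT (fun v : mV => v i ord0).
Proof.
move=> _ B mB; rewrite setTI; apply: sub_sigma_algebra.
by exists i, B.
Qed.

Lemma measurable_colP d (T : measurableType d) (h : T -> mV) :
  (forall i, measurable_fun setT (fun x => h x i ord0)) -> measurable_fun setT h.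
Proof.
move=> mh; apply: (@measurability _ _ T mV setT h (@coord_cylinders R n)) => //.
by move=> _ [_ [i [B [mB ->]]] <-]; exact: mh _ _ mB.
Qed.

(** An open set is a countable union of balls with rational centers and radii, and each ball is a
    finite intersection of coordinate cylinders. *)
Lemma open_measurable_col (U : set 'cV[R]_n) : open U -> measurable (U : set mV).
Proof.
move=> oU.
pose ratc (c : 'cV[rat]_n) : 'cV[R]_n := map_mx ratr c.
pose D := [set p : 'cV[rat]_n * rat | 0 < p.2 /\ ball (ratc p.1) (ratr p.2) `<=` U].
have -> : U = \bigcup_(p in D) ball (ratc p.1) (ratr p.2).
  apply/seteqP; split => [x Ux|x [p [_ pU] /pU]//].
  have /nbhs_ballP[e /= e0 xeU] : nbhs x U by exact: open_nbhs_nbhs.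
  have e20 : 0 < e / 2 by rewrite divr_gt0.
  have [q] := rat_in_itvoo e20; rewrite in_itv /= => /andP[q0 qe].
  have H i : exists r : rat, `|x i ord0 - ratr r| < ratr q.
    have xq : x i ord0 - ratr q < x i ord0 + ratr q by rewrite ltrD2l gtrN.
    have [r] := rat_in_itvoo xq.
    by rewrite in_itv /= => xr; exists r; rewrite distrC ltr_distl.
  have [c cP] := choice H.
  have bx : ball (ratc (\col_i c i)) (ratr q) x.
    by split => // i j; rewrite /ball /= !mxE !ord1 distrC.
  exists (\col_i c i, q) => //=; split; first by rewrite -(ltr0q R).
  move=> y cy; apply: xeU; rewrite [e]splitr.
  apply: (@le_ball _ _ x (ratr q + ratr q)); first by rewrite lerD// ltW.
  by apply: ball_triangle cy; exact: ball_sym.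
rewrite bigcup_mkcond; apply: countable_bigcupT_measurable => [|[c q]]; first exact: countableP.
case: ifP => // /set_mem[/= q0 _].
have -> : ball (ratc c) (ratr q) = \bigcap_(i in [set: 'I_n])
    (fun v : mV => v i ord0) @^-1` ball (ratc c i ord0) (ratr q).
  apply/seteqP; split => [v [_ cv] i _|v cv]; first exact: cv.
  by split => [|i j]; rewrite ?ltr0q// ord1; exact: cv.
apply: fin_bigcap_measurable => [|i _]; first exact: finite_finset.
rewrite -[X in measurable X]setTI; apply: measurable_coord => //.
exact: measurable_realfun.measurable_ball.
Qed.

Lemma continuous_measurable_col (g : 'cV[R]_n -> R) :
  continuous g -> measurable_fun setT (g : mV -> R).
Proof.
move=> /continuousP cg; apply: (measurability _ (RGenOpens.measurableE R)).
move=> _ [_ [a [b ->] <-]]; rewrite setTI.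
apply: open_measurable_col; apply: cg; exact: interval_open.
Qed.

Definition upd (z : 'cV[R]_n) (i : 'I_n) (t : R) : 'cV[R]_n :=
  \col_j (if j == i then t else z j ord0).

Lemma updE z i t j : upd z i t j ord0 = if j == i then t else z j ord0.
Proof. by rewrite mxE. Qed.

Lemma measurable_upd (i : 'I_n) :
  measurable_fun setT (fun p : mV * R => upd p.1 i p.2 : mV).
Proof.
apply: measurable_colP => j.
have [ji|ji] := eqVneq j i.
  rewrite (_ : (fun _ => _) = snd) //.
  by apply/funext => p; rewrite updE ji eqxx.
rewrite (_ : (fun _ => _) = (fun p : mV * R => p.1 j ord0)).
  exact: (measurableT_comp (measurable_coord j)).
by apply/funext => p; rewrite updE (negbTE ji).
Qed.

End measurable_columns.

(** * Iterated Lebesgue integrals *)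

Section lebesgue_translation.
Context {R : realType}.
Local Open Scope ereal_scope.
Local Notation mu := (@lebesgue_measure R).

Lemma lebesgue_measure_translation (a : R) (A : set R) : measurable A ->
  pushforward mu (+%R a : _ -> measurableTypeR R) A = mu A.
Proof.
move=> mA; apply/esym/lebesgue_measure_unique => //= [|ma _ [[x y] _ <-]].
  exact: measurable_funD.
rewrite /pushforward.
have -> : +%R a @^-1` `]x, y]%classic = `](x - a)%R, (y - a)%R]%classic.
  by apply/funext => t; apply/propext; rewrite /= !in_itv /= ltrBlDl lerBrDl.
rewrite !lebesgue_measure_itv /= !lte_fin ltrD2r; case: ifP => // _.
by rewrite -!EFinB; congr EFin; ring.
Qed.

Lemma ge0_integral_translation (a : R) (F : R -> \bar R) :
  measurable_fun [set: R] F -> (forall t, 0 <= F t) ->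
  \int[mu]_t F (a + t)%R = \int[mu]_t F t.
Proof.
move=> mF F0.
have ma : measurable_fun [set: measurableTypeR R] (+%R a : _ -> measurableTypeR R).
  exact: measurable_funD.
transitivity (\int[pushforward mu (+%R a : _ -> measurableTypeR R)]_t F t).
  by rewrite ge0_integral_pushforward.
by apply: eq_measure_integral => A mA _; exact: lebesgue_measure_translation.
Qed.

End lebesgue_translation.

Section iterated_integral.
Context {R : realType} {n : nat}.
Local Notation mV := (mcol R n).
Local Notation mu := (@lebesgue_measure R).
Implicit Types (F : 'cV[R]_n -> \bar R) (s : seq 'I_n) (z v : 'cV[R]_n).
Local Open Scope ereal_scope.

(** Integrates the coordinates listed in [s], the head outermost, the others being frozen at [z]; a
    stand-in for Lebesgue measure on columns. *)
Fixpoint iint s F z : \bar R :=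
  if s is i :: s' then \int[mu]_t iint s' F (upd z i t) else F z.

Lemma iint_ge0 s F z : (forall z, 0 <= F z) -> 0 <= iint s F z.
Proof.
by move=> F0; elim: s z => [//|i s IH] z; apply: integral_ge0.
Qed.

Lemma measurable_upd_r z i : measurable_fun setT (fun t : R => upd z i t : mV).
Proof.
exact: (measurableT_comp (measurable_upd i) (pair1_measurable (z : mV))).
Qed.

Lemma measurable_iint s F : measurable_fun setT (F : mV -> \bar R) ->
  (forall z, 0 <= F z) -> measurable_fun setT (iint s F : mV -> \bar R).
Proof.
move=> mF F0; elim: s => [//|i s IH] /=.
apply: (@measurable_fun_fubini_tonelli_F _ _ mV _ R mu
  (fun p : mV * R => iint s F (upd p.1 i p.2))).
  exact: (measurableT_comp IH (measurable_upd i)).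
by move=> p; exact: iint_ge0.
Qed.

Lemma le_iint s F F' z : measurable_fun setT (F : mV -> \bar R) ->
  measurable_fun setT (F' : mV -> \bar R) ->
  (forall z, 0 <= F z) -> (forall z, F z <= F' z) ->
  iint s F z <= iint s F' z.
Proof.
move=> mF mF' F0 FF'.
have F'0 x : 0 <= F' x by apply: le_trans (FF' x).
elim: s z => [//|i s IH] z; apply: ge0_le_integral => //.
- by move=> t _; exact: iint_ge0.
- exact: (measurableT_comp (measurable_iint s mF F0) (measurable_upd_r z i)).
- exact: (measurableT_comp (measurable_iint s mF' F'0) (measurable_upd_r z i)).
Qed.

Lemma iintZl s F (g : 'cV[R]_n -> R) z : measurable_fun setT (F : mV -> \bar R) ->
  (forall z, 0 <= F z) -> (forall z, 0 <= g z)%R ->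
  (forall z i t, i \in s -> g (upd z i t) = g z) ->
  iint s (fun z => (g z)%:E * F z) z = (g z)%:E * iint s F z.
Proof.
move=> mF F0 g0; elim: s z => [//|i s IH] z gs /=.
rewrite -ge0_integralZl ?lee_fin//.
- apply: eq_integral => t _; rewrite IH.
    by rewrite gs ?mem_head.
  by move=> y j u js; rewrite gs// in_cons js orbT.
- exact: (measurableT_comp (measurable_iint s mF F0) (measurable_upd_r z i)).
- by move=> t _; exact: iint_ge0.
Qed.

Lemma iint_eq_off s F z z' :
  (forall i, i \notin s -> z i ord0 = z' i ord0) -> iint s F z = iint s F z'.
Proof.
elim: s z z' => [z z' zz'|i s IH z z' zz'] /=.
  by congr F; apply/matrixP => i j; rewrite !ord1 zz'.
apply: eq_integral => t _; apply: IH => j js; rewrite !updE.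
by case: eqVneq => // ji; rewrite zz'// in_cons negb_or ji.
Qed.

Lemma iint_translation s F v z : measurable_fun setT (F : mV -> \bar R) ->
  (forall z, 0 <= F z) ->
  iint s (fun z => F (v + z)%R) z = iint s F (v + z)%R.
Proof.
move=> mF F0; elim: s z => [//|i s IH] z /=.
rewrite -[RHS](ge0_integral_translation (v i ord0)); first last.
- by move=> t; exact: iint_ge0.
- exact: (measurableT_comp (measurable_iint s mF F0) (measurable_upd_r (v + z)%R i)).
apply: eq_integral => t _; rewrite IH; congr (iint _ _ _).
by apply/matrixP => j k; rewrite !ord1 !mxE; case: eqVneq => [->|].
Qed.

End iterated_integral.

(** * Independent pairs *)

Section independent_pair.
Context {R : realType} {d d1 d2} {T : measurableType d} {T1 : measurableType d1}
  {T2 : measurableType d2} (P : probability T R).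
Variables (X1 : {mfun T >-> T1}) (X2 : {mfun T >-> T2}) (N : probability T2 R).
Local Open Scope ereal_scope.

Lemma measurable_pairing : measurable_fun setT (fun w => (X1 w, X2 w)).
Proof. exact: measurable_fun_pair. Qed.

(** Both sides are measures in [D] that agree on rectangles. The event [C] is carried along so that
    independence from further variables extends to the pair. *)
Lemma independent_pair (C : set T) (c : R) : (0 <= c)%R -> measurable C ->
  (forall A B, measurable A -> measurable B ->
    P (X1 @^-1` A `&` X2 @^-1` B `&` C) = c%:E * (P (X1 @^-1` A) * N B)) ->
  forall D, measurable D ->
    P ((fun w => (X1 w, X2 w)) @^-1` D `&` C) = c%:E * (distribution P X1 \x N) D.
Proof.
move=> c0 mC PC D mD; pose k := NngNum c0.
transitivity ((distribution P X1 \x mscale k N) D).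
  apply/esym/(product_measure_unique
    (m' := pushforward (mrestr P mC) (fun w => (X1 w, X2 w)))) => //=.
    exact: measurable_pairing.
  move=> _ A B mA mB.
  rewrite /pushforward /mrestr /mscale muleCA; exact: PC.
pose m' : {measure set (T1 * T2) -> \bar R} := mscale k (distribution P X1 \x N).
rewrite -[RHS]/(m' D).
apply: (product_measure_unique (m' := m')) => // A B mA mB.
transitivity (c%:E * (distribution P X1 \x N) (A `*` B)) => //.
by rewrite product_measure1E// muleCA.
Qed.

Lemma ge0_expectation_independent_pair (F : T1 * T2 -> \bar R) :
  (forall A B, measurable A -> measurable B ->
    P (X1 @^-1` A `&` X2 @^-1` B) = P (X1 @^-1` A) * N B) ->
  measurable_fun setT F -> (forall x, 0 <= F x) ->
  \int[P]_w F (X1 w, X2 w) = \int[P]_w \int[N]_y F (X1 w, y).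
Proof.
move=> PN mF F0.
transitivity (\int[pushforward P (fun w => (X1 w, X2 w))]_p F p).
  by rewrite ge0_integral_pushforward//; exact: measurable_pairing.
transitivity (\int[distribution P X1 \x N]_p F p).
  apply: eq_measure_integral => [|mX D mD _]; first exact: measurable_pairing.
  have := @independent_pair setT 1%R ler01 measurableT _ D mD.
  rewrite setIT mul1e => /= H; rewrite /pushforward H// => A B mA mB.
  by rewrite setIT mul1e; exact: PN.
rewrite fubini_tonelli1//= ge0_integral_distribution//.
- exact: measurable_fun_fubini_tonelli_F.
- by move=> x; exact: integral_ge0.
Qed.

End independent_pair.

Section independent_pair_functions.
Context {R : realType} {d d1 d2} {T : measurableType d} {T1 : measurableType d1}
  {T2 : measurableType d2} {P : probability T R} {X1 : T -> T1} {X2 : T -> T2}.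
Hypotheses (mX1 : measurable_fun setT X1) (mX2 : measurable_fun setT X2).
Variable N : probability T2 R.
Local Open Scope ereal_scope.
Hypothesis PN : forall A B, measurable A -> measurable B ->
  P (X1 @^-1` A `&` X2 @^-1` B) = P (X1 @^-1` A) * N B.

Let Y1 : {mfun T >-> T1} := mfun_Sub (mem_set mX1).
Let Y2 : {mfun T >-> T2} := mfun_Sub (mem_set mX2).

Lemma ge0_expectation_pair (F : T1 * T2 -> \bar R) :
  measurable_fun setT F -> (forall x, 0 <= F x) ->
  \int[P]_w F (X1 w, X2 w) = \int[P]_w \int[N]_y F (X1 w, y).
Proof. exact: (ge0_expectation_independent_pair (X1 := Y1) (X2 := Y2) PN). Qed.

Lemma independent_pair_event (C : set T) (c : R) : (0 <= c)%R -> measurable C ->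
  (forall A B, measurable A -> measurable B ->
    P (X1 @^-1` A `&` X2 @^-1` B `&` C) = c%:E * (P (X1 @^-1` A) * N B)) ->
  forall D, measurable D ->
    P ((fun w => (X1 w, X2 w)) @^-1` D `&` C) =
    c%:E * P ((fun w => (X1 w, X2 w)) @^-1` D).
Proof.
move=> c0 mC PC D mD.
rewrite (independent_pair (X1 := Y1) (X2 := Y2) c0 mC PC mD); congr (_ * _).
have PT A B : measurable A -> measurable B ->
    P (Y1 @^-1` A `&` Y2 @^-1` B `&` setT) = 1%:E * (P (Y1 @^-1` A) * N B).
  by move=> mA mB; rewrite setIT mul1e; exact: PN.
have := independent_pair ler01 measurableT PT mD.
by rewrite setIT mul1e => <-.
Qed.

End independent_pair_functions.

(** * The law of a structural causal model *)

Section normal_integral.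
Context {R : realType}.
Local Open Scope ereal_scope.
Local Notation mu := (@lebesgue_measure R).

(** The Radon-Nikodym derivative and [normal_pdf] have equal integrals over measurable sets, hence
    agree almost everywhere. *)
Lemma ge0_integral_normal_prob (m s : R) (F : R -> \bar R) :
  measurable_fun [set: R] F -> (forall x, 0 <= F x) ->
  \int[normal_prob m s]_x F x = \int[mu]_x (F x * (normal_pdf m s x)%:E).
Proof.
move=> mF F0; have dom := normal_prob_dominates m s.
rewrite -(Radon_Nikodym_SigmaFinite.change_of_variables dom F0 measurableT mF).
set g := Radon_Nikodym_SigmaFinite.f _ _.
have mg : mu.-integrable setT g := Radon_Nikodym_SigmaFinite.f_integrable dom.
have mpdf : measurable_fun setT (fun x => (normal_pdf m s x)%:E).
  by apply/measurable_EFinP; exact: measurable_normal_pdf.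
have gpdf : ae_eq mu setT g (fun x => (normal_pdf m s x)%:E).
  apply: integral_ae_eq => // D _ mD.
  by rewrite -(Radon_Nikodym_SigmaFinite.f_integral dom).
apply: ae_eq_integral => //.
- by apply: emeasurable_funM => //; exact: measurable_int mg.
- exact: emeasurable_funM.
- by apply: filterS gpdf => x /= /[apply] ->.
Qed.

Lemma ge0_integral_normal_shift (a s : R) (F : R -> \bar R) :
  measurable_fun [set: R] F -> (forall x, 0 <= F x) ->
  \int[normal_prob 0 s]_x F (a + x)%R = \int[mu]_t ((normal_pdf 0 s (t - a))%:E * F t).
Proof.
move=> mF F0.
have mpdf : measurable_fun setT (fun t : R => (normal_pdf 0 s (t - a))%:E).
  apply/measurable_EFinP; apply: (measurableT_comp (measurable_normal_pdf 0 s)).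
  exact: measurable_funB.
have mFa : measurable_fun [set: R] (fun x => F (a + x)%R).
  by apply: (measurableT_comp mF); exact: measurable_funD.
rewrite (ge0_integral_normal_prob _ _ mFa (fun x => F0 _)).
pose K (t : R) : \bar R := (normal_pdf 0 s (t - a))%:E * F t.
have mK : measurable_fun [set: R] K by exact: emeasurable_funM.
have K0 t : 0 <= K t by rewrite mule_ge0// lee_fin normal_pdf_ge0.
rewrite -(ge0_integral_translation a mK K0).
by apply: eq_integral => x _; rewrite /K [(a + x - a)%R]addrC addKr muleC.
Qed.

End normal_integral.

Section scm_law.
Context {R : realType} {n : nat} {G : rel 'I_n} {f : 'I_n -> 'cV[R]_n -> R}
  {sigma : 'I_n -> R} {d : measure_display} {T : measurableType d}
  {P : probability T R} {E : 'I_n -> T -> R}.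
Hypothesis fG : forall i, depends_only_on_parents G i (f i).
Hypothesis f_cont : forall i, continuous (f i).
Hypothesis G_irr : forall i, ~~ G i i.
Hypothesis mE : forall i, measurable_fun setT (E i).
Local Notation mV := (mcol R n).
Local Notation mu := (@lebesgue_measure R).
Local Notation N i := (normal_prob 0 (sigma i)).
Implicit Types (z : 'cV[R]_n) (s : seq 'I_n) (W : T -> 'cV[R]_n).
Local Open Scope ereal_scope.

(** Solves the structural equations node by node along [s]; each node must come after its
    parents. *)
Fixpoint run s (e : 'I_n -> R) z : 'cV[R]_n :=
  if s is i :: s' then run s' e (upd z i (f i z + e i)) else z.

Definition topological s := pairwise (fun i j => (i != j) && ~~ G j i) s.

Definition density s z : R :=
  (\prod_(i <- s) normal_pdf 0 (sigma i) (z i ord0 - f i z))%R.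

(* [W] is independent of the noises that are still to be consumed. *)
Definition indep_rest W s := measurable_fun setT (W : T -> mV) /\
  forall (A : set mV) (B : 'I_n -> set R),
    measurable A -> (forall i, measurable (B i)) ->
    P (W @^-1` A `&` [set w | forall i, i \in s -> B i (E i w)]) =
    P (W @^-1` A) * \prod_(i <- s) N i (B i).

Lemma density_ge0 s z : (0 <= density s z)%R.
Proof. by apply: prodr_ge0 => i _; exact: normal_pdf_ge0. Qed.

Lemma measurable_structural i : measurable_fun setT (f i : mV -> R).
Proof. exact: continuous_measurable_col. Qed.

Lemma measurable_density s : measurable_fun setT (density s : mV -> R).
Proof.
apply: (@measurable_prod _ mV) => i _.
apply: (measurableT_comp (measurable_normal_pdf 0 (sigma i))).
apply: measurable_funB; [exact: measurable_coord|exact: measurable_structural].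
Qed.

Lemma structural_upd i j z t : ~~ G j i -> f i (upd z j t) = f i z.
Proof.
move=> nG; apply: fG => k Gki; rewrite updE ifN//.
by apply: contraNneq nG => <-.
Qed.

Lemma measurable_step i : measurable_fun setT
  (fun p : mV * R => upd p.1 i (f i p.1 + p.2) : mV).
Proof.
have mpair : measurable_fun setT (fun p : mV * R => (p.1 : mV, (f i p.1 + p.2)%R)).
  apply: measurable_fun_pair; first exact: measurable_fst.
  apply: measurable_funD; last exact: measurable_snd.
  exact: (measurableT_comp (measurable_structural i) measurable_fst).
exact: (measurableT_comp (measurable_upd i) mpair).
Qed.

Lemma indep_rest_cons i s W (A : set mV) (B0 : set R) (B : 'I_n -> set R) :
  i \notin s -> indep_rest W (i :: s) -> measurable A -> measurable B0 ->
  (forall j, measurable (B j)) ->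
  P (W @^-1` A `&` E i @^-1` B0 `&` [set w | forall j, j \in s -> B j (E j w)]) =
  P (W @^-1` A) * N i B0 * \prod_(j <- s) N j (B j).
Proof.
move=> nis [_ indep] mA mB0 mB.
pose B' j := if j == i then B0 else B j.
have mB' j : measurable (B' j) by rewrite /B'; case: ifP.
have E' j : j \in s -> B' j = B j.
  by rewrite /B'; case: eqVneq => // ->; rewrite (negbTE nis).
have := indep A B' mA mB'; rewrite big_cons {2}/B' eqxx muleA.
rewrite [in X in _ = X -> _]big_seq (eq_bigr (fun j => N j (B j))); last first.
  by move=> j js; rewrite E'.
rewrite -big_seq => <-; congr (P _); apply/seteqP; split => w /=.
  move=> [[Aw Bw] Bs]; split => // j; rewrite in_cons => /predU1P[->|js].
    by rewrite /B' eqxx.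
  by rewrite E'//; exact: Bs.
move=> [Aw Bw]; split; first split => //.
  by have := Bw i (mem_head _ _); rewrite /B' eqxx.
by move=> j js; rewrite -E'//; apply: Bw; rewrite in_cons js orbT.
Qed.

Lemma indep_rest_head i s W (A : set mV) (B : set R) :
  i \notin s -> indep_rest W (i :: s) -> measurable A -> measurable B ->
  P (W @^-1` A `&` E i @^-1` B) = P (W @^-1` A) * N i B.
Proof.
move=> nis indep mA mB.
have := indep_rest_cons nis indep mA mB (fun=> measurableT).
rewrite (_ : [set w | _] = setT); last by apply/seteqP; split.
rewrite setIT => ->; rewrite big1 ?mule1// => j _; exact: probability_setT.
Qed.

Lemma measurable_rest s (B : 'I_n -> set R) : (forall j, measurable (B j)) ->
  measurable [set w | forall j, j \in s -> B j (E j w)].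
Proof.
move=> mB.
rewrite (_ : [set w | _] = \bigcap_(j in [set j | j \in s]) (E j @^-1` B j)); last by [].
apply: fin_bigcap_measurable => [|j _]; first exact: finite_finset.
by rewrite -[X in measurable X]setTI; exact: mE.
Qed.

(** The new column is a measurable function of the pair [(W, E i)], which is independent of the
    later noises by [independent_pair_event]. *)
Lemma indep_rest_step i s W : i \notin s -> indep_rest W (i :: s) ->
  indep_rest (fun w => upd (W w) i (f i (W w) + E i w)) s.
Proof.
move=> nis indep; have [mW _] := indep.
have mEi : measurable_fun setT (E i : T -> measurableTypeR R) by exact: mE.
have mWE : measurable_fun setT (fun w => (W w : mV, E i w)).
  exact: measurable_fun_pair.
split; first exact: (measurableT_comp (measurable_step i) mWE).
move=> A B mA mB.
pose D := (fun p : mV * measurableTypeR R => upd p.1 i (f i p.1 + p.2) : mV) @^-1` A.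
have mD : measurable D by rewrite -[D]setTI; exact: (measurable_step i).
have cfin : \prod_(j <- s) N j (B j) \is a fin_num.
  by apply: prode_fin_num => j _; apply: fin_num_measure; exact: mB.
have c0 : 0 <= \prod_(j <- s) N j (B j) by apply: prode_ge0.
rewrite -(fineK cfin) muleC.
apply: (independent_pair_event mW mEi (N := N i) _ _ (measurable_rest s mB) _ mD).
- by move=> A' B' mA' mB'; exact: indep_rest_head nis indep mA' mB'.
- exact: fine_ge0.
- move=> A' B' mA' mB'; rewrite (fineK cfin) muleC.
  exact: indep_rest_cons.
Qed.

Lemma expectation_step i s W (F : mV -> \bar R) :
  i \notin s -> indep_rest W (i :: s) -> measurable_fun setT F ->
  (forall z, 0 <= F z) ->
  \int[P]_w F (upd (W w) i (f i (W w) + E i w)) =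
  \int[P]_w \int[mu]_t
    ((normal_pdf 0 (sigma i) (t - f i (W w)))%:E * F (upd (W w) i t)).
Proof.
move=> nis indep mF F0; have [mW _] := indep.
have mEi : measurable_fun setT (E i : T -> measurableTypeR R) by exact: mE.
have PN (A : set mV) (B : set (measurableTypeR R)) : measurable A -> measurable B ->
    P (W @^-1` A `&` E i @^-1` B) = P (W @^-1` A) * N i B.
  exact: indep_rest_head nis indep.
pose K (p : mV * measurableTypeR R) := F (upd p.1 i (f i p.1 + p.2)).
have mK : measurable_fun setT K by exact: (measurableT_comp mF (measurable_step i)).
have K0 p : 0 <= K p by exact: F0.
have -> := ge0_expectation_pair mW mEi PN mK K0.
apply: eq_integral => w _.
rewrite -(ge0_integral_normal_shift (f i (W w)) (sigma i)
  (F := fun t => F (upd (W w) i t)))//.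
exact: (measurableT_comp mF (measurable_upd_r (W w) i)).
Qed.

(** Each consumed noise contributes one Gaussian factor. In a topological order this factor ignores
    the coordinates updated later, so it can be moved inside the remaining integrals. *)
Lemma expectation_run s W (F : mV -> \bar R) :
  topological s -> indep_rest W s -> measurable_fun setT F -> (forall z, 0 <= F z) ->
  \int[P]_w F (run s (E ^~ w) (W w)) =
  \int[P]_w iint s (fun z => (density s z)%:E * F z) (W w).
Proof.
move=> + + mF F0; elim: s W => [|i s IH] W topo indep.
  by apply: eq_integral => w _ /=; rewrite /density big_nil mul1e.
have [/allP Gi tops] : all (fun j => (i != j) && ~~ G j i) s /\ topological s.
  by apply/andP; move: topo; rewrite /topological pairwise_cons.
have nis : i \notin s by apply/negP => /Gi; rewrite eqxx.
have mdF : measurable_fun setT (fun z : mV => (density s z)%:E * F z).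
  by apply: emeasurable_funM => //; apply/measurable_EFinP; exact: measurable_density.
have dF0 z : 0 <= (density s z)%:E * F z by rewrite mule_ge0// lee_fin density_ge0.
rewrite /= IH//; last exact: indep_rest_step.
rewrite (expectation_step nis indep (F := iint s _)); first last.
- by move=> z; exact: iint_ge0.
- exact: measurable_iint.
apply: eq_integral => w _; apply: eq_integral => t _.
pose g z := normal_pdf 0 (sigma i) (z i ord0 - f i z).
have gs z j u : j \in s -> g (upd z j u) = g z.
  move=> /Gi /andP[ij nG]; rewrite /g structural_upd// updE ifN//.
have -> : normal_pdf 0 (sigma i) (t - f i (W w)) = g (upd (W w) i t).
  by rewrite /g updE eqxx structural_upd.
rewrite -iintZl//.
- by congr (iint s _ _); apply/funext => z; rewrite /density big_cons EFinM muleA.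
- by move=> z; exact: normal_pdf_ge0.
Qed.

End scm_law.

(** * Density of the solution in causal order *)

Section solution_law.
Context {R : realType} {n : nat} {G : rel 'I_n} {f : 'I_n -> 'cV[R]_n -> R}
  {sigma : 'I_n -> R} {lay : 'I_n -> nat}.
Hypothesis M : layered_scm G f sigma lay.
Hypothesis f_cont : forall i, continuous (f i).
Local Notation mV := (mcol R n).
Local Notation mu := (@lebesgue_measure R).
Local Notation N i := (normal_prob 0 (sigma i)).
Implicit Types (z v : 'cV[R]_n) (s : seq 'I_n) (U : set 'cV[R]_n).
Local Open Scope ereal_scope.

Let fG := scm_parents M.

Lemma layered_irreflexive i : ~~ G i i.
Proof. by apply/negP => /(scm_lay M); rewrite ltnn. Qed.

Lemma run_solution s (e : 'I_n -> R) z (zsol : 'cV[R]_n) : topological (G := G) s ->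
  (forall i, zsol i ord0 = f i zsol + e i)%R ->
  (forall i, i \notin s -> z i ord0 = zsol i ord0) ->
  run (f := f) s e z = zsol.
Proof.
move=> + sol; elim: s z => [|i s IH] z.
  by move=> _ zz; apply/matrixP => i j; rewrite !ord1 zz.
rewrite /topological pairwise_cons => /andP[/allP Gi tops] zz; apply: IH => // j js.
rewrite updE; case: eqVneq => [->|ji]; last by apply: zz; rewrite in_cons negb_or ji.
rewrite sol; congr (_ + _)%R; apply: fG => k Gki; apply: zz.
rewrite in_cons negb_or; apply/andP; split.
  by apply: contraTneq Gki => ->; exact: layered_irreflexive.
by apply: contraTN Gki => /Gi /andP[].
Qed.

(** Layers decrease along edges, so sorting by decreasing layer puts parents first. *)
Definition causal_order : seq 'I_n := sort (fun i j => lay j <= lay i)%N (enum 'I_n).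

Lemma mem_causal_order i : i \in causal_order.
Proof. by rewrite mem_sort mem_enum. Qed.

Lemma topological_causal_order : topological (G := G) causal_order.
Proof.
rewrite /topological.
rewrite -[pairwise _ _]/(pairwise [rel i j |
  [rel i j : 'I_n | i != j] i j && [rel i j : 'I_n | ~~ G j i] i j] causal_order).
rewrite pairwise_relI -uniq_pairwise sort_uniq enum_uniq /=.
apply: (@sub_pairwise _ (fun i j => lay j <= lay i)%N) => [i j ji|].
  by apply/negP => /(scm_lay M); rewrite ltnNge ji.
rewrite -sorted_pairwise; first by apply: sort_sorted => i j; exact: leq_total.
by move=> i j k /= ij jk; exact: leq_trans jk ij.
Qed.

Definition gauss_const : R := (\prod_(i <- causal_order) normal_peak (sigma i))%R.

Lemma gauss_const_gt0 : (0 < gauss_const)%R.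
Proof.
apply: prodr_gt0 => i _; apply: normal_peak_gt0.
by rewrite gt_eqF// (scm_sigma M).
Qed.

Lemma density_energy z : density (f := f) (sigma := sigma) causal_order z =
  (gauss_const * expR (- energy f sigma lay 0 z / 2))%R.
Proof.
rewrite /energy /= -sumrN mulr_suml expR_sum.
rewrite [X in (_ * X)%R](_ : _ = \prod_(i <- causal_order)
    expR (- (noise f z i ord0 / sigma i) ^+ 2 / 2))%R; last first.
  rewrite -[LHS]big_enum /=; apply: perm_big.
  by rewrite perm_sym perm_sort.
rewrite -big_split; apply: eq_bigr => i _ /=.
have si : sigma i != 0%R by rewrite gt_eqF// (scm_sigma M).
rewrite normal_pdfE// /normal_fun mxE; congr (_ * expR _)%R.
by rewrite subr0; field.
Qed.

Definition vol U : \bar R := iint causal_order (fun z => (\1_U z)%:E) 0%R.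

Lemma measurable_indic_col U : open U -> measurable_fun setT (fun z : mV => (\1_U z : R)%:E).
Proof.
by move=> oU; apply/measurable_EFinP/measurable_indic; exact: open_measurable_col.
Qed.

Lemma vol_translation U v : open U -> vol [set z | U (v + z)%R] = vol U.
Proof.
move=> oU; have ind0 z : 0 <= (\1_U z : R)%:E by rewrite lee_fin.
have := iint_translation causal_order v 0%R (measurable_indic_col oU) ind0.
rewrite (@iint_eq_off _ _ _ _ (v + 0)%R 0%R) => [H|i]; first by rewrite /vol -H.
by rewrite mem_causal_order.
Qed.

Lemma iint_ball_ge s (c : 'cV[R]_n) (r : R) z : (0 < r)%R ->
  (forall i, i \notin s -> ball (c i ord0) r (z i ord0)) ->
  ((r *+ 2) ^+ size s)%:E <= iint s (fun z => (\1_(ball c r) z)%:E) z.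
Proof.
move=> r0; elim: s z => [|i s IH] z zc /=.
  rewrite indicE mem_set ?expr0//; split => // i j.
  by rewrite ord1; exact: zc.
have mF := measurable_indic_col (ball_open c r).
apply: (@le_trans _ _ (\int[mu]_t (((r *+ 2) ^+ size s)%:E * (\1_(ball (c i ord0) r) t)%:E))).
  rewrite ge0_integralZl//; last 2 first.
  - by apply/measurable_EFinP/measurable_indic; exact: measurable_realfun.measurable_ball.
  - by rewrite lee_fin exprn_ge0// mulrn_wge0// ltW.
  rewrite integral_indic//; last exact: measurable_realfun.measurable_ball.
  rewrite setIT; apply: (@le_trans _ _ (((r *+ 2) ^+ size s)%:E * mu (ball (c i ord0) r))) => //.
  by rewrite (lebesgue_measure_ball _ (ltW r0)) -EFinM exprSr.
apply: ge0_le_integral => //.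
- by move=> t _; rewrite -EFinM lee_fin mulr_ge0// exprn_ge0// mulrn_wge0// ltW.
- apply/measurable_EFinP/measurable_funM => //.
  by apply: measurable_indic; exact: measurable_realfun.measurable_ball.
- apply: (measurableT_comp (measurable_iint s mF _) (measurable_upd_r z i)).
  by move=> x; rewrite lee_fin.
move=> t _; rewrite indicE; case: (boolP (t \in _)) => [/set_mem tc|_]; last first.
  by rewrite mule0; apply: iint_ge0 => x; rewrite lee_fin.
rewrite mule1; apply: IH => j js; rewrite updE; case: eqVneq => [->//|ji].
by apply: zc; rewrite in_cons negb_or ji.
Qed.

Lemma vol_gt0 U : open U -> U !=set0 -> 0 < vol U.
Proof.
move=> oU [c Uc].
have /nbhs_ballP[r /= r0 rU] : nbhs c U by exact: open_nbhs_nbhs.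
apply: (@lt_le_trans _ _ ((r *+ 2) ^+ size causal_order)%:E).
  by rewrite lte_fin exprn_gt0// mulrn_wgt0.
apply: (@le_trans _ _ (iint causal_order (fun z => (\1_(ball c r) z)%:E) 0%R)).
  by apply: iint_ball_ge => // i; rewrite mem_causal_order.
apply: le_iint.
- exact: (measurable_indic_col (ball_open c r)).
- exact: measurable_indic_col.
- by move=> z; rewrite lee_fin.
- move=> z; rewrite lee_fin !indicE; have [cz|ncz] := pselect (ball c r z).
    by rewrite !mem_set//; exact: rU.
  by rewrite memNset.
Qed.

Section random_solution.
Context {d : measure_display} {T : measurableType d} {P : probability T R}
  {E : 'I_n -> T -> R} {Z : T -> 'cV[R]_n}.
Hypothesis mE : forall i, measurable_fun setT (E i).
Hypothesis indepE : mutually_independent P E.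
Hypothesis lawE : forall i (A : set R), measurable A -> P (E i @^-1` A) = N i A.
Hypothesis Zsol : forall w i, (Z w i ord0 = f i (Z w) + E i w)%R.

Lemma run_causal_order w : run (f := f) causal_order (E ^~ w) 0%R = Z w.
Proof.
apply: run_solution => [|i|i]; [exact: topological_causal_order|exact: Zsol|].
by rewrite mem_causal_order.
Qed.

Lemma measurable_solution : measurable_fun setT (Z : T -> mV).
Proof.
suff H s (W : T -> 'cV[R]_n) : measurable_fun setT (W : T -> mV) ->
    measurable_fun setT (fun w => run (f := f) s (E ^~ w) (W w) : mV).
  have := H causal_order (fun=> 0%R) (measurable_cst _).
  by under eq_fun do rewrite run_causal_order.
elim: s W => [//|i s IH] W mW /=; apply: IH.
have mWE : measurable_fun setT (fun w => (W w : mV, E i w)).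
  exact: measurable_fun_pair.
exact: (measurableT_comp (measurable_step f_cont i) mWE).
Qed.

Lemma indep_rest_causal_order :
  indep_rest (sigma := sigma) (P := P) (E := E) (fun=> 0%R) causal_order.
Proof.
split; first exact: measurable_cst.
move=> A B mA mB.
have PB : P [set w | forall i, i \in causal_order -> B i (E i w)] =
    \prod_(i <- causal_order) N i (B i).
  transitivity (P (\bigcap_(i in [set: 'I_n]) (E i @^-1` B i))).
    congr (P _); apply/seteqP; split => w /= BE i _; last exact: BE.
    by apply: BE; exact: mem_causal_order.
  rewrite indepE// (eq_bigr (fun i => N i (B i))) => [|i _]; last exact: lawE.
  rewrite -[LHS]big_enum /=; apply: perm_big.
  by rewrite perm_sym perm_sort.
have [A0|A0] := pselect (A 0%R).
  rewrite (_ : _ @^-1` A = setT); last by apply/seteqP; split.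
  by rewrite setTI PB probability_setT mul1e.
rewrite (_ : _ @^-1` A = set0); last by apply/seteqP; split.
by rewrite set0I measure0 mul0e.
Qed.

Lemma solution_law U : open U -> P (Z @^-1` U) =
  iint causal_order
    (fun z => (density (f := f) (sigma := sigma) causal_order z)%:E * (\1_U z)%:E) 0%R.
Proof.
move=> oU.
have mU := open_measurable_col oU.
have mZU : measurable (Z @^-1` U).
  by rewrite -[X in measurable X]setTI; exact: measurable_solution.
transitivity (\int[P]_w (\1_U (run (f := f) causal_order (E ^~ w) 0%R) : R)%:E).
  under eq_integral do rewrite run_causal_order.
  by rewrite -[in LHS](setIT (Z @^-1` U)) -integral_indic.
rewrite (expectation_run fG f_cont layered_irreflexive mE
  topological_causal_order indep_rest_causal_order (measurable_indic_col oU)).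
  by rewrite integral_cst// -[RHS]mule1; congr (_ * _); exact: probability_setT.
by move=> z; rewrite lee_fin.
Qed.

Local Notation dens := (density (f := f) (sigma := sigma) causal_order).

Lemma measurable_density_indic U : open U ->
  measurable_fun setT (fun z : mV => (dens z)%:E * (\1_U z)%:E).
Proof.
move=> oU; apply: emeasurable_funM; last exact: measurable_indic_col.
by apply/measurable_EFinP; exact: measurable_density.
Qed.

Lemma iintZ_indic (c : R) U : (0 <= c)%R -> open U ->
  iint causal_order (fun z => c%:E * (\1_U z)%:E) 0%R = c%:E * vol U.
Proof.
move=> c0 oU; apply: (iintZl (g := fun=> c)) => //; exact: measurable_indic_col.
Qed.

Lemma law_le_vol (c : R) U : (0 <= c)%R -> open U ->
  (forall z, U z -> (dens z <= c)%R) -> P (Z @^-1` U) <= c%:E * vol U.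
Proof.
move=> c0 oU Uc; rewrite solution_law// -iintZ_indic//; apply: le_iint.
- exact: measurable_density_indic.
- by apply: measurable_funeM; exact: measurable_indic_col.
- by move=> z; rewrite -EFinM lee_fin mulr_ge0// density_ge0.
- move=> z; rewrite -!EFinM lee_fin indicE.
  by case: (boolP (z \in U)) => [/set_mem /Uc|_]; rewrite ?mulr1// !mulr0.
Qed.

Lemma vol_le_law (c : R) U : (0 <= c)%R -> open U ->
  (forall z, U z -> (c <= dens z)%R) -> c%:E * vol U <= P (Z @^-1` U).
Proof.
move=> c0 oU Uc; rewrite solution_law// -iintZ_indic//; apply: le_iint.
- by apply: measurable_funeM; exact: measurable_indic_col.
- exact: measurable_density_indic.
- by move=> z; rewrite -EFinM lee_fin mulr_ge0.
- move=> z; rewrite -!EFinM lee_fin indicE.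
  by case: (boolP (z \in U)) => [/set_mem /Uc|_]; rewrite ?mulr1// !mulr0.
Qed.

End random_solution.

End solution_law.

(** * Density ratios *)

Section column_continuity.
Context {R : realType}.

Lemma continuous_col (X : topologicalType) n (h : X -> 'cV[R]_n) :
  (forall i, continuous (fun x => h x i ord0)) -> continuous h.
Proof.
move=> hc x A [B /= nB BA].
have : \forall y \near x, forall i, B i ord0 (h y i ord0).
  by apply: filter_forall => i; exact: hc (nB i ord0).
by apply: filterS => y hB; apply: BA => i j; rewrite ord1.
Qed.

Lemma mulmx_continuous m n (A : 'M[R]_(m, n)) : continuous (fun z : 'cV[R]_n => A *m z).
Proof.
apply: continuous_col => i.
have -> : (fun z : 'cV[R]_n => (A *m z) i ord0) =
    (fun z => \sum_(j <- index_enum 'I_n) A i j * z j ord0).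
  by apply/funext => z; rewrite mxE.
apply: (continuous_big (@add_continuous R)) => j _ z.
by apply: (@continuousM R); [exact: cst_continuous|exact: coord_continuous].
Qed.

Lemma translation_continuous n (v : 'cV[R]_n) : continuous (fun z : 'cV[R]_n => v + z).
Proof.
apply: continuous_col => i.
have -> : (fun z : 'cV[R]_n => (v + z) i ord0) = (fun z => v i ord0 + z i ord0).
  by apply/funext => z; rewrite mxE.
by move=> z; apply: (@continuousD _ R); [exact: cst_continuous|exact: coord_continuous].
Qed.

Lemma open_preimage (X Y : topologicalType) (h : X -> Y) (U : set Y) :
  continuous h -> open U -> open (h @^-1` U).
Proof. by move=> hc; apply: open_comp => x _; exact: hc. Qed.

End column_continuity.

(** What is retained of a continuous positive density: [qd_shift] bounds the mass of the translate
    by [v] of a small set near [z]. The reference integral, which depends on the causal order, no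
    longer appears, so that two models become comparable. *)
Record quasi_density (R : realType) n (nu : set 'cV[R]_n -> \bar R) (p : 'cV[R]_n -> R)
    : Prop := QuasiDensity {
  qd_gt0 : forall U, open U -> U !=set0 -> (0 < nu U)%E;
  qd_le1 : forall U, open U -> (nu U <= 1)%E;
  qd_pos : forall z, 0 < p z;
  qd_shift : forall z v (k : R), 0 < k -> p (v + z) < k * p z ->
    exists O, [/\ open O, O z & forall U, open U -> U `<=` O ->
      (nu [set y | U (- v + y)%R] <= k%:E * nu U)%E] }.

Section scm_quasi_density.
Context {R : realType} {n : nat} {G : rel 'I_n} {f : 'I_n -> 'cV[R]_n -> R}
  {sigma : 'I_n -> R} {lay : 'I_n -> nat}.
Hypothesis M : layered_scm G f sigma lay.
Hypothesis f_cont : forall i, continuous (f i).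
Context {d : measure_display} {T : measurableType d} {P : probability T R}
  {E : 'I_n -> T -> R} {Z : T -> 'cV[R]_n}.
Hypothesis mE : forall i, measurable_fun setT (E i).
Hypothesis indepE : mutually_independent P E.
Hypothesis lawE : forall i (A : set R), measurable A ->
  P (E i @^-1` A) = normal_prob 0 (sigma i) A.
Hypothesis Zsol : forall w i, Z w i ord0 = f i (Z w) + E i w.

Local Notation dens := (density (f := f) (sigma := sigma) (causal_order (lay := lay))).
Local Notation vol := (@vol R n lay).

Lemma density_continuous : continuous dens.
Proof.
apply: (continuous_big (@mul_continuous R)) => i _ z.
have si : sigma i != 0 by rewrite gt_eqF// (scm_sigma M).
apply: (@continuous_comp _ _ _ (fun z : 'cV[R]_n => z i ord0 - f i z)
  (normal_pdf 0 (sigma i))); last exact: continuous_normal_pdf.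
by apply: (@continuousB _ R); [exact: coord_continuous|exact: f_cont].
Qed.

Lemma density_gt0 z : 0 < dens z.
Proof.
by rewrite (density_energy M) mulr_gt0 ?expR_gt0// (gauss_const_gt0 M).
Qed.

Lemma measurable_law U : open U -> measurable (Z @^-1` U).
Proof.
move=> oU; rewrite -[X in measurable X]setTI.
by apply: (measurable_solution M f_cont mE Zsol) => //; exact: open_measurable_col.
Qed.

Lemma scm_quasi_density : quasi_density (fun U => P (Z @^-1` U)) dens.
Proof.
have ub (c : R) U := law_le_vol M f_cont mE indepE lawE Zsol (c := c) (U := U).
have lb (c : R) U := vol_le_law M f_cont mE indepE lawE Zsol (c := c) (U := U).
split.
- move=> U oU [u Uu]; have pu := density_gt0 u.
  pose O := U `&` dens @^-1` [set y | dens u / 2 < y].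
  have oO : open O.
    by apply: openI => //; apply: (open_preimage density_continuous); exact: open_gt.
  apply: (@lt_le_trans _ _ ((dens u / 2)%:E * vol O)%E).
    rewrite mule_gt0 ?lte_fin ?divr_gt0//; apply: vol_gt0 => //.
    by exists u; split => //=; lra.
  apply: (@le_trans _ _ (P (Z @^-1` O))).
    by apply: lb => // [|z [_ /ltW]//]; rewrite divr_ge0// ltW.
  apply: le_measure; rewrite ?inE; [exact: measurable_law|exact: measurable_law|].
  by move=> w [].
- by move=> U oU; exact/probability_le1/measurable_law.
- exact: density_gt0.
- move=> z v k k0 pz; have pvz := density_gt0 (v + z).
  (* A value strictly between [dens (v + z)] and [k * dens z]: near [z] it bounds the shifted
     density from above and [k] times the density from below, and [vol] is translation invariant. *)
  pose m := (dens (v + z) + k * dens z) / 2.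
  have m0 : 0 < m by rewrite /m; lra.
  exists ((fun y => dens (v + y)) @^-1` [set x | x < m] `&` dens @^-1` [set x | m / k < x]).
  split.
  + apply: openI; last by apply: (open_preimage density_continuous); exact: open_gt.
    apply: open_preimage; last exact: open_lt.
    move=> y; apply: (@continuous_comp _ _ _ (fun y => v + y) dens).
      exact: translation_continuous.
    exact: density_continuous.
  + by split; rewrite /= ?ltr_pdivrMr// /m; lra.
  move=> U oU UO.
  apply: (@le_trans _ _ (m%:E * vol U)%E).
    rewrite -(vol_translation (lay := lay) (- v) oU); apply: ub; first exact: ltW.
      by apply: (@open_preimage _ _ (fun y => - v + y)) => //; exact: translation_continuous.
    by move=> y /UO [/= /ltW + _]; rewrite addNKr.
  have -> : (m%:E * vol U = k%:E * ((m / k)%:E * vol U))%E.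
    by rewrite muleA -EFinM mulrC divfK// gt_eqF.
  apply: lee_wpmul2l; first by rewrite lee_fin ltW.
  by apply: lb => // [|y /UO [_ /ltW]//]; rewrite divr_ge0// ltW.
Qed.

End scm_quasi_density.

Section quasi_density_ratio.
Context {R : realType} {n : nat} {nu nu' : set 'cV[R]_n -> \bar R}
  {p p' : 'cV[R]_n -> R} {A B : 'M[R]_n}.
Hypotheses (qd : quasi_density nu p) (qd' : quasi_density nu' p').
Hypotheses (AB : A *m B = 1%:M) (BA : B *m A = 1%:M).
Hypothesis nuE : forall U, open U -> nu U = nu' [set z | U (A *m z)].

(** Otherwise, translating a small open set by [v] with the bound of one model, and back with the
    bound of the other, would multiply its positive finite mass by a factor [< 1]. *)
Lemma density_ratio_le z v : p (A *m z) * p' (v + z) <= p (A *m (v + z)) * p' z.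
Proof.
rewrite leNgt; apply/negP => lt_ratio.
set a := p (A *m z) in lt_ratio; set b := p (A *m (v + z)) in lt_ratio.
set a' := p' z in lt_ratio; set b' := p' (v + z) in lt_ratio.
have a0 : 0 < a by exact: (qd_pos qd).
have b0 : 0 < b by exact: (qd_pos qd).
have a0' : 0 < a' by exact: (qd_pos qd').
have b0' : 0 < b' by exact: (qd_pos qd').
pose rho := b * a' / (a * b').
have rho0 : 0 < rho by rewrite divr_gt0// mulr_gt0.
have rho1 : rho < 1 by rewrite ltr_pdivrMr ?mulr_gt0// mul1r.
(* Leaves slack in both shifts: [t > 1], yet [rho * t ^ 2 < 1] because [4 rho < (1 + rho)^2]. *)
pose t := 2 / (1 + rho).
have t1 : 1 < t by rewrite /t ltr_pdivlMr; lra.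
pose k1 := b / a * t; pose k2 := a' / b' * t.
have t0 : 0 < t by apply: lt_trans t1.
have k10 : 0 < k1 by rewrite mulr_gt0// divr_gt0.
have k20 : 0 < k2 by rewrite mulr_gt0// divr_gt0.
have k12 : k1 * k2 < 1.
  have -> : k1 * k2 = rho * t ^+ 2.
    by rewrite /k1 /k2 /rho; field; rewrite !gt_eqF.
  rewrite /t expr_div_n mulrA ltr_pdivrMr ?exprn_gt0//; last by lra.
  by nra.
have bk1 : p (A *m v + A *m z) < k1 * p (A *m z).
  by rewrite -mulmxDr -/a -/b /k1 mulrAC divfK ?gt_eqF// ltr_pMr.
have [V1 [oV1 V1z sh1]] := qd_shift qd k10 bk1.
have bk2 : p' (- v + (v + z)) < k2 * p' (v + z).
  by rewrite addKr -/a' -/b' /k2 mulrAC divfK ?gt_eqF// ltr_pMr.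
have [V2 [oV2 V2z sh2]] := qd_shift qd' k20 bk2.
pose U2 := V2 `&` [set y | V1 (A *m (- v + y))].
have oU2 : open U2.
  apply: openI => //; apply: (@open_preimage _ _ (fun y => A *m (- v + y))) => // y.
  apply: (@continuous_comp _ _ _ (fun y => - v + y) (fun y => A *m y)).
    exact: translation_continuous.
  exact: mulmx_continuous.
have U2z : U2 (v + z) by split => //=; rewrite addKr.
(* [U1] is [U2] translated back by [v] and mapped by [A], so both shift bounds apply to the same
   set. *)
pose U1 := [set x | U2 (v + B *m x)].
have oU1 : open U1.
  apply: (@open_preimage _ _ (fun x => v + B *m x)) => // y.
  apply: (@continuous_comp _ _ _ (fun y => B *m y) (fun y => v + y)).
    exact: mulmx_continuous.
  exact: translation_continuous.
have U1O1 : U1 `<=` V1.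
  by move=> x [_ /=]; rewrite addKr mulmxA AB mul1mx.
have oU1v : open [set y | U1 (- (A *m v) + y)].
  by apply: (@open_preimage _ _ (fun y => - (A *m v) + y)) => //; exact: translation_continuous.
have := sh1 U1 oU1 U1O1; rewrite !nuE//.
have -> : [set y | [set y | U1 (- (A *m v) + y)] (A *m y)] = U2.
  apply/funext => y; rewrite /U1 /= -mulmxN -mulmxDr mulmxA BA mul1mx.
  by rewrite addNKr.
have -> : [set y | U1 (A *m y)] = [set y | U2 (- - v + y)].
  by apply/funext => y; rewrite /U1 /= mulmxA BA mul1mx opprK.
move=> le1; have le2 := sh2 U2 oU2 (@subIsetl _ _ _).
have : (nu' U2 <= (k1 * k2)%:E * nu' U2)%E.
  have -> : ((k1 * k2)%:E * nu' U2 = k1%:E * (k2%:E * nu' U2))%E by rewrite muleA EFinM.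
  apply: le_trans le1 _.
  by apply: lee_wpmul2l le2; rewrite lee_fin ltW.
have gt0 := qd_gt0 qd' oU2 (ex_intro _ _ U2z); have le1' := qd_le1 qd' oU2.
have fin : nu' U2 \is a fin_num.
  by rewrite ge0_fin_numE ?ltW// (le_lt_trans le1')// ltry.
rewrite -(fineK fin) -EFinM lee_fin leNgt => /negP; apply.
by rewrite gtr_pMl// fine_gt0// gt0 (le_lt_trans le1')// ltry.
Qed.

Lemma density_ratio z v : p (A *m z) * p' (v + z) = p (A *m (v + z)) * p' z.
Proof.
apply: le_anti; rewrite density_ratio_le /=.
by have := density_ratio_le (v + z) (- v); rewrite addKr.
Qed.

End quasi_density_ratio.

(** * Identification *)

Section identification.
Context {R : realType} {n : nat}.

Lemma energy_ge0 (f : 'I_n -> 'cV[R]_n -> R) sigma lay k z : 0 <= energy f sigma lay k z.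
Proof. by apply: sumr_ge0 => i _; exact: sqr_ge0. Qed.

Lemma noise0_energy0 (f : 'I_n -> 'cV[R]_n -> R) sigma lay k z :
  noise f z = 0 -> energy f sigma lay k z = 0.
Proof.
by move=> z0; rewrite /energy big1// => i _; rewrite z0 mxE mul0r expr0n.
Qed.

(* The two energies differ by a constant because the two densities are proportional;
   the constant vanishes because both energies have minimum [0]. *)
Lemma energy_identified {G f sigma lay G' f' sigma' lay'} {A B : 'M[R]_n} {nu nu'} :
  layered_scm G f sigma lay -> layered_scm G' f' sigma' lay' ->
  A *m B = 1%:M -> B *m A = 1%:M ->
  quasi_density nu (density (f := f) (sigma := sigma) (causal_order (lay := lay))) ->
  quasi_density nu' (density (f := f') (sigma := sigma') (causal_order (lay := lay'))) ->
  (forall U, open U -> nu U = nu' [set z | U (A *m z)]) ->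
  forall z, energy f sigma lay 0 (A *m z) = energy f' sigma' lay' 0 z.
Proof.
move=> M M' AB BA qd qd' nuE.
have sum_eq z y : energy f sigma lay 0 (A *m z) + energy f' sigma' lay' 0 y =
    energy f sigma lay 0 (A *m y) + energy f' sigma' lay' 0 z.
  have := density_ratio qd qd' AB BA nuE z (y - z).
  rewrite subrK !(density_energy M) !(density_energy M').
  rewrite ![_ * expR _ * _]mulrACA -!expRD => /mulfI.
  have K0 : gauss_const (sigma := sigma) (lay := lay) *
      gauss_const (sigma := sigma') (lay := lay') != 0.
    by rewrite mulf_neq0// gt_eqF// ?(gauss_const_gt0 M)// (gauss_const_gt0 M').
  by move=> /(_ K0) /expR_inj; lra.
have [y y0] := noise_surj M' 0; have [x x0] := noise_surj M 0.
move=> z; have := sum_eq z y; have := sum_eq (B *m x) y.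
rewrite mulmxA AB mul1mx (noise0_energy0 _ _ _ x0) (noise0_energy0 _ _ _ y0).
have := energy_ge0 f sigma lay 0 (A *m y).
by have := energy_ge0 f' sigma' lay' 0 (B *m x); lra.
Qed.

(** The variances and the probability space are hidden, since reading off the noise only takes [H]
    and [f]. *)
Definition generates d (pX : set 'cV[R]_d -> \bar R) (G : rel 'I_n)
    (H : 'M[R]_(d, n)) (f : 'I_n -> 'cV[R]_n -> R) : Prop :=
  exists (sigma : 'I_n -> R) (dT : measure_display) (T : measurableType dT)
    (P : probability T R) (E : 'I_n -> T -> R) (Z : T -> 'cV[R]_n),
  (\rank H = n /\ dag G) /\
  [/\ forall i, depends_only_on_parents G i (f i),
      forall i, twice_cont_diff (f i),
      forall i, directionally_nonlinear G i (f i) &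
      forall i, 0 < sigma i] /\
  [/\ forall i, measurable_fun setT (E i),
      mutually_independent P E,
      forall i (A : set R), measurable A -> P (E i @^-1` A) = normal_prob 0 (sigma i) A,
      forall w i, Z w i ord0 = f i (Z w) + E i w &
      forall A : set 'cV[R]_d, open A -> pX A = P ((fun w => H *m Z w) @^-1` A)].

Lemma generates_law d (pX : set 'cV[R]_d -> \bar R) G H f : generates pX G H f ->
  exists sigma lay nu, [/\ layered_scm G f sigma lay,
    (forall i, in_layer G (lay i) i) /\ nu set0 = 0%E,
    quasi_density nu (density (f := f) (sigma := sigma) (causal_order (lay := lay))),
    pinvmx H *m H = 1%:M &
    forall U, open U -> pX U = nu [set z | U (H *m z)]].
Proof.
move=> [sigma [dT [T [P [E [Z [[rH dG] [[fG f2 fN s0] [mE iE lE ZE pXE]]]]]]]]].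
have [lay [layP layG child]] := exists_layering dG.
have M : layered_scm G f sigma lay by split.
exists sigma, lay, (fun U => P (Z @^-1` U)); split => //.
- by split; rewrite // preimage_set0 measure0.
- apply: (scm_quasi_density M _ mE iE lE ZE) => i.
  exact: twice_cont_diff_continuous.
- by apply: mulVpmx; rewrite /row_full rH.
Qed.

(** [D] kills the column space of [H'], so the open set where [D x] is nonzero is null for the
    second model. If [D *m H] were nonzero, its preimage by [H] would be open and nonempty, hence of
    positive mass for the first. *)
Lemma generates_image d (pX : set 'cV[R]_d -> \bar R) G H f G' H' f' :
  generates pX G H f -> generates pX G' H' f' -> H = H' *m (pinvmx H' *m H).
Proof.
move=> /generates_law[sg [lay [nu [M _ qd HV pXE]]]].
move=> /generates_law[sg' [lay' [nu' [M' [_ nu'0] qd' HV' pXE']]]].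
pose D := 1%:M - H' *m pinvmx H'.
suff DH : D *m H = 0.
  by apply/eqP; rewrite mulmxA -subr_eq0 -[X in X - _]mul1mx -mulmxBl DH.
pose U := (fun x : 'cV[R]_d => D *m x) @^-1` ~` [set 0].
have oU : open U.
  apply: (open_preimage (@mulmx_continuous _ _ _ D)); apply: closed_openC.
  exact/accessible_closed_set1/hausdorff_accessible/norm_hausdorff.
have U0 : pX U = 0%E.
  rewrite pXE' // (_ : [set z | _] = set0)//.
  apply/seteqP; split => // z /=; apply.
  by rewrite /D mulmxA mulmxBl mul1mx -mulmxA HV' mulmx1 subrr mul0mx.
have oHU : open [set z | U (H *m z)] by exact: (open_preimage (@mulmx_continuous _ _ _ H)).
have [//|/matrix0Pn[i [j Dij]]] := eqVneq (D *m H) 0.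
have : [set z | U (H *m z)] !=set0.
  exists (delta_mx j ord0) => /= E; move/eqP: Dij; apply.
  have := congr1 (fun v : 'cV[R]_d => v i ord0) E.
  by rewrite mulmxA -colE !mxE.
by move=> /(qd_gt0 qd oHU); rewrite -pXE // U0 ltxx.
Qed.

Theorem noise_identified d (pX : set 'cV[R]_d -> \bar R) G H f G' H' f' :
  generates pX G H f -> generates pX G' H' f' ->
  exists (s : 'S_n) (C : 'M[R]_n), (forall i, C i i != 0) /\ layer_block G C /\
    forall z, noise f' (pinvmx H' *m (H *m z)) = perm_mx s *m C *m noise f z.
Proof.
move=> g g'; have HE := generates_image g g'; have HE' := generates_image g' g.
move: g g' => /generates_law[sg [lay [nu [M [layP _] qd HV pXE]]]].
move=> /generates_law[sg' [lay' [nu' [M' _ qd' HV' pXE']]]].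
pose A := pinvmx H *m H'; pose B := pinvmx H' *m H.
have AB : A *m B = 1%:M by rewrite /A -mulmxA -HE.
have BA : B *m A = 1%:M by rewrite /B -mulmxA -HE'.
have nuE U : open U -> nu U = nu' [set z | U (A *m z)].
  move=> oU; have oHU : open [set x | U (pinvmx H *m x)].
    exact: (open_preimage (@mulmx_continuous _ _ _ (pinvmx H))).
  (* The models share only the values of [pX] on open sets, so [U] is written as the preimage under
     [H] of an open set. *)
  rewrite (_ : U = [set z | [set x | U (pinvmx H *m x)] (H *m z)]); last first.
    by apply/funext => z /=; rewrite mulmxA HV mul1mx.
  rewrite -pXE // pXE' //; congr nu'; apply/funext => z /=.
  by rewrite !mulmxA HV mul1mx.
have [N [uN N0 NE]] := noise_linear M M' AB BA (energy_identified M M' AB BA qd qd' nuE).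
have [s [C [NC C1 C0]]] := unitmx_block_perm uN N0.
exists s, C; split => //; split.
  move=> k i j ki kj; apply: C0; apply/eqP => ij; apply: kj.
  by rewrite (in_layer_inj ki (layP i)) ij; exact: layP.
by move=> z; rewrite mulmxA -/B NE mulmxA AB mul1mx NC.
Qed.

End identification.


Theorem theorem2 (R : realType) (n d : nat) : (0 < n)%N -> (0 < d)%N ->
  exists Learn : (set 'cV[R]_d -> \bar R) -> 'cV[R]_d -> 'cV[R]_n,
  forall (H : 'M[R]_(d, n)) (G : rel 'I_n) (f : 'I_n -> 'cV[R]_n -> R)
         (sigma : 'I_n -> R)
         (dT : measure_display) (T : measurableType dT) (P : probability T R)
         (E : 'I_n -> T -> R) (Z : T -> 'cV[R]_n)
         (pX : set 'cV[R]_d -> \bar R),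
    \rank H = n ->
    dag G ->
    (forall i, depends_only_on_parents G i (f i)) ->
    (forall i, twice_cont_diff (f i)) ->
    (forall i, directionally_nonlinear G i (f i)) ->
    (forall i, measurable_fun setT (E i)) ->
    mutually_independent P E ->
    (forall i, 0 < sigma i) ->
    (forall i (A : set R), measurable A ->
       P (E i @^-1` A) = normal_prob 0 (sigma i) A) ->
    (* structural equations Z_i = f_i(Z_pa(i)) + E_i *)
    (forall w i, Z w i ord0 = f i (Z w) + E i w) ->
    (* pX is the distribution of X = H Z (determined by its values on open sets) *)
    (forall A : set 'cV[R]_d, open A -> pX A = P ((fun w => H *m Z w) @^-1` A)) ->
    exists (s : 'S_n) (C : 'M[R]_n),
      (forall i, C i i != 0) /\ layer_block G C /\
      forall (e z : 'cV[R]_n),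
        (forall i, z i ord0 = f i z + e i ord0) ->
        Learn pX (H *m z) = perm_mx s *m C *m e.
Proof.
move=> _ _.
(* The default pair is returned only if no model generates [pX], which the true model excludes. *)
pose model pX := xget (0 : 'M[R]_(d, n), fun _ _ => 0)
  [set m : 'M[R]_(d, n) * ('I_n -> 'cV[R]_n -> R) | exists G, generates pX G m.1 m.2].
exists (fun pX x => noise (model pX).2 (pinvmx (model pX).1 *m x)).
move=> H G f sigma dT T P E Z pX rH dG fG f2 fN mE iE s0 lE ZE pXE.
have g : generates pX G H f by exists sigma, dT, T, P, E, Z.
have [G' g'] : exists G', generates pX G' (model pX).1 (model pX).2.
  by apply: (@xgetPex _ _ [set m | exists G, generates pX G m.1 m.2]); exists (H, f), G.
have [s [C [C1 [CG CE]]]] := noise_identified g g'.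
exists s, C; split => //; split => // e z ze.
rewrite CE; congr (_ *m _).
by apply/matrixP => i j; rewrite !ord1 mxE ze addrC addKr.
Qed.
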